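(* Let $(E,d)$ be a Polish space, $E_1'$ a Borel subset of $\mathbb{R}^e$, $E_2'$ a Polish space, $F:E\times E_1'\times E_2'\to E$ measurable, and set $f_t(x)=F(x,Z_{t-1},\varepsilon_t)$, $f_s^t=f_t\circ\cdots\circ f_s$ for $s\le t$ (with $f_t^{t-1}(x)=x$), and $\mathcal{F}_t=\sigma((Z_j,\varepsilon_j):j\le t)$. Let $p\ge1$ and $x_0\in E$ be such that: (A0) $Z=(Z_t)_{t\in\mathbb{Z}}$ is an $E_1'$-valued stationary ergodic process, $(\varepsilon_t)_{t\in\mathbb{Z}}$ is an i.i.d. $E_2'$-valued sequence, independent of $Z$; (A1') for every $z\in E_1'$, $\mathbb{E}[d^p(F(x_0,z,\varepsilon_1),x_0)]<\infty$; (A2') there is a measurable $\kappa:E_1'\to(0,\infty)$ with $\mathbb{E}[\log^+\kappa(Z_0)]<\infty$, $\mathbb{E}[\log\kappa(Z_0)]<0$, such that for all $(x,y)\in E^2$ and $z\in E_1'$, $\mathbb{E}[d^p(F(x,z,\varepsilon_0),F(y,z,\varepsilon_0))]\le\kappa^p(z)d^p(x,y)$; moreover $\mathbb{E}\big[\log^+\int d^p(x_0,F(x_0,Z_0,u))\,d\mathbb{P}_{\varepsilon_1}(u)\big]<\infty$. Then: 1. For every $(x,t)\in E\times\mathbb{Z}$ there is a random variable $X_t(x)$ with $\mathbb{E}[d^p(X_t(x),x_0)\mid Z]<\infty$ a.s. and $\lim_{s\to\infty}\mathbb{E}[d^p(f_{t-s}^t(x),X_t(x))\mid Z]=0$ a.s.;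 also $f_{t-s}^t(x)\to X_t(x)$ a.s. as $s\to\infty$. 2. For $x\neq y$, $\mathbb{P}(X_t(x)\ne X_t(y))=0$; one sets $X_t=X_t(x)$. 3. The process $((X_t,Z_t))_{t\in\mathbb{Z}}$ is stationary and ergodic. 4. If $(Y_t)_{t\in\mathbb{Z}}$ is non-anticipative ($Y_t$ is $\mathcal{F}_t$-measurable), $((Y_t,Z_t))_t$ is stationary, $Y_t=f_t(Y_{t-1})$ for all $t$, and $\mathbb{E}[d^p(Y_0,x_0)\mid Z_0,Z_{-1},\dots]<\infty$ a.s., then $Y_t=X_t$ a.s.
   Context: $\mathbb{E}[\,\cdot\mid Z]$ denotes conditional expectation given the whole process $(Z_t)_{t\in\mathbb{Z}}$. $\log^+(x)=\log x$ if $x\ge1$ and $0$ otherwise. $\mathbb{P}_{\varepsilon_1}$ is the law of $\varepsilon_1$. *)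

(* Defs.v *)
From HB Require Import structures.
From mathcomp Require Import all_boot all_order all_algebra.
From mathcomp Require Import all_classical all_reals all_analysis.
From mathcomp Require Import measurable_realfun.
Set Implicit Arguments. Unset Strict Implicit. Unset Printing Implicit Defensive.
Import Order.TTheory GRing.Theory Num.Theory.
Local Open Scope classical_set_scope.
Local Open Scope ring_scope.

Section Defs.
Variable R : realType.

Definition is_metric (T : Type) (dist : T -> T -> R) :=
  [/\ (forall x y, 0 <= dist x y),
      (forall x y, dist x y = 0 <-> x = y),
      (forall x y, dist x y = dist y x) &
      (forall x y z, dist x z <= dist x y + dist y z)].

Definition metric_complete (T : Type) (dist : T -> T -> R) :=
  forall u : nat -> T,
    (forall eps, 0 < eps -> exists N, forall m n, (N <= m)%N -> (N <= n)%N ->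
        dist (u m) (u n) < eps) ->
    exists l, forall eps, 0 < eps -> exists N, forall n, (N <= n)%N ->
        dist (u n) l < eps.

Definition metric_separable (T : Type) (dist : T -> T -> R) :=
  exists D : set T, countable D /\
    forall x eps, 0 < eps -> exists y, D y /\ dist x y < eps.

Definition metric_open (T : Type) (dist : T -> T -> R) (U : set T) :=
  forall x, U x -> exists r, 0 < r /\ forall y, dist x y < r -> U y.

Definition polish_borel d (T : measurableType d) (dist : T -> T -> R) :=
  [/\ is_metric dist, metric_complete dist, metric_separable dist &
      @measurable _ T = <<s [set U | metric_open dist U] >>].

Definition logp (x : R) : R := if 1 <= x then ln x else 0.
Definition elogp (x : \bar R) : \bar R :=
  match x with
  | r%:E => (logp r)%:E
  | +oo%E => +oo%E
  | -oo%E => 0%E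
  end.

Definition sigma_gen dO (Omega : measurableType dO) (I : Type) dT
    (T : measurableType dT) (Y : I -> Omega -> T) (J : set I) : set (set Omega) :=
  <<s [set B | exists i, J i /\ exists A, measurable A /\ B = Y i @^-1` A] >>.

Definition sigma_gen2 dO (Omega : measurableType dO) (I : Type) dT dU
    (T : measurableType dT) (U : measurableType dU)
    (Y : I -> Omega -> T) (W : I -> Omega -> U) (J : set I) : set (set Omega) :=
  <<s [set B | exists i, J i /\
        ((exists A, measurable A /\ B = Y i @^-1` A) \/
         (exists A, measurable A /\ B = W i @^-1` A))] >>.

Definition cond_exp_version dO (Omega : measurableType dO)
    (P : probability Omega R) (G : set (set Omega))
    (W : Omega -> \bar R) (g : Omega -> \bar R) :=
  [/\ (forall B : set (\bar R), measurable B -> G (g @^-1` B)),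
      (forall w, (0 <= g w)%E) &
      (forall A, G A -> (\int[P]_(w in A) g w = \int[P]_(w in A) W w)%E)].

Definition cylinders dT (T : measurableType dT) : set (set (int -> T)) :=
  [set C | exists t : int, exists A, measurable A /\ C = [set w | A (w t)]].

Definition path_measurable dT (T : measurableType dT) (B : set (int -> T)) :=
  <<s @cylinders _ T >> B.

Definition shift (T : Type) (w : int -> T) : int -> T := fun t => w (t + 1)%R.

Definition path_of dO (Omega : measurableType dO) (T : Type)
    (Y : int -> Omega -> T) (w : Omega) : int -> T := fun t => Y t w.

Definition stationary dO (Omega : measurableType dO) (P : probability Omega R)
    dT (T : measurableType dT) (Y : int -> Omega -> T) :=
  forall B, path_measurable B ->
    P [set w | B (shift (path_of Y w))] = P [set w | B (path_of Y w)].

Definition ergodic dO (Omega : measurableType dO) (P : probability Omega R)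
    dT (T : measurableType dT) (Y : int -> Omega -> T) :=
  forall B, path_measurable B -> (@shift T) @^-1` B = B ->
    P [set w | B (path_of Y w)] = 0%E \/ P [set w | B (path_of Y w)] = 1%E.

Definition mutually_independent dO (Omega : measurableType dO)
    (P : probability Omega R) dT (T : measurableType dT) (Y : int -> Omega -> T) :=
  forall (s : seq int) (A : int -> set T), uniq s -> (forall t, measurable (A t)) ->
    P (\bigcap_(t in [set` s]) (Y t @^-1` A t)) =
    (\prod_(t <- s) fine (P (Y t @^-1` A t)))%:E.

Definition identically_distributed dO (Omega : measurableType dO)
    (P : probability Omega R) dT (T : measurableType dT) (Y : int -> Omega -> T) :=
  forall t (A : set T), measurable A -> P (Y t @^-1` A) = P (Y 0 @^-1` A).

Definition independent_sigma dO (Omega : measurableType dO)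
    (P : probability Omega R) (G H : set (set Omega)) :=
  forall A B, G A -> H B -> P (A `&` B) = (P A * P B)%E.

(** ** The iterated random maps:  fcomp F Z eps s n x w = f_{s+n-1} o ... o f_s (x),
    where f_t(x) = F(x, Z_{t-1}, eps_t).  Thus f_s^t = fcomp s (t - s + 1). *)
Definition frand (E E1 E2 : Type) (Omega : Type) (F : E * E1 * E2 -> E)
    (Z : int -> Omega -> E1) (eps : int -> Omega -> E2) (t : int) (x : E) (w : Omega) : E :=
  F (x, Z (t - 1)%R w, eps t w).

Fixpoint fcomp (E E1 E2 : Type) (Omega : Type) (F : E * E1 * E2 -> E)
    (Z : int -> Omega -> E1) (eps : int -> Omega -> E2) (s : int) (n : nat)
    (x : E) (w : Omega) : E :=
  match n with
  | 0%N => x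
  | n'.+1 => frand F Z eps (s + n'%:Z)%R (fcomp F Z eps s n' x w) w
  end.

End Defs.

(* Main.v *)
(* Write phi_n = f_{t-n+1}^t(x0).  Integrating out the noise one step at a time,
   E[1_A d^p(phi_n, phi_{n+1})] <= E[1_A kappa^p(Z_{t-1}) ... kappa^p(Z_{t-n}) c(Z_{t-n-1})]
   for every event A of sigma(Z), where c(z) = E d^p(x0, F(x0, z, eps)).  By the
   maximal ergodic lemma applied to log kappa (truncated from below) and to
   +-log^+ c, the product on the right decays exponentially a.s.; on the event A
   where it is at most C rho^n for all n, everything is summable.  This yields the
   limit X_t, and conditional expectations are only ever integrated over such
   events A, which exhaust the space.  The limit does not depend on the starting
   point, so X_t(x) is taken to be X_t(x0).  A stationary solution Y is compared
   with phi_n by the same contraction started from Y_{t-n}, on the events where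
   E[d^p(Y_{t-n}, x0) | Z_j, j <= t-n] <= M, whose probabilities do not depend on n.
   (X, Z) is a factor of (Z, eps), which is ergodic: for an invariant set B the
   map z |-> P(B | Z = z) is invariant, and it is {0,1}-valued because B and its
   shifts become conditionally independent given Z. *)
Require Import Defs.
From HB Require Import structures.
From mathcomp Require Import all_boot all_order all_algebra.
From mathcomp Require Import all_classical all_reals all_analysis.
From mathcomp Require Import measurable_realfun.
From mathcomp Require Import zify ring lra.
Set Implicit Arguments. Unset Strict Implicit. Unset Printing Implicit Defensive.
Import Order.TTheory GRing.Theory Num.Theory numFieldNormedType.Exports.
Local Open Scope classical_set_scope.
Local Open Scope ring_scope.

(** * Polish spaces *)

(** Only logarithmic moments of [kappa] and [c] are assumed, so the expectation of d^p(X_t, x0) may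
    be infinite: no bound can be integrated over the whole space, and every estimate has to be
    localised by an event of sigma(Z). This is why the past contains the whole environment, its
    future included: indicators of such events and all factors [kappa (Z j)] are then known at every
    time, while the next noise is still independent of what is known. Upper bounds on ergodic sums
    suffice, so the maximal lemma takes the place of the pointwise ergodic theorem. In the
    ergodicity of the joint process no mixing of [Z] is available: only the noise decouples, and the
    environment stays frozen in both quantities that are compared. *)

Section Polish.
Context (R : realType) (dE : measure_display) (E : measurableType dE).
Variable dist : E -> E -> R.
Hypothesis HE : polish_borel dist.

Lemma dist_ge0 x y : 0 <= dist x y. Proof. by case: HE => -[]. Qed.

Lemma dist_eq0P x y : dist x y = 0 <-> x = y.
Proof. by case: HE => -[] _ H _ _ _ _ _; exact: H. Qed.

Lemma distxx x : dist x x = 0. Proof. exact/dist_eq0P. Qed.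

Lemma distC x y : dist x y = dist y x. Proof. by case: HE => -[]. Qed.

Lemma dist_triangle y x z : dist x z <= dist x y + dist y z.
Proof. by case: HE => -[]. Qed.

Lemma metric_open_measurable (U : set E) : metric_open dist U -> measurable U.
Proof. by case: HE => _ _ _ ->; exact: sub_sigma_algebra. Qed.

Lemma measurable_distl y : measurable_fun setT (fun x => dist x y).
Proof.
apply: (measurability _ (RGenInftyO.measurableE R)) => _ [_ [r ->] <-].
rewrite setTI; apply: metric_open_measurable => x /=; rewrite in_itv/= => xr.
exists (r - dist x y); split; first by rewrite subr_gt0.
move=> z xz; rewrite /= in_itv/=.
by have := dist_triangle x z y; rewrite (distC z x); lra.
Qed.

(** Separability puts the sets [dist < r] into the product sigma-algebra: a triangle through a point
    [q n] of a countable dense family turns such a set into a countable union of sets defined by the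
    distances of each coordinate to [q n]. *)
Lemma measurable_dist : measurable_fun setT (fun z : E * E => dist z.1 z.2).
Proof.
have [D [cD dD]] : metric_separable dist by case: HE.
have [q qD] : exists q : nat -> E, forall x r, 0 < r -> exists n, dist x (q n) < r.
  have [D0|[q]] := pfcard_geP cD.
    by have [y []] := dD point 1 ltr01; rewrite D0.
  exists q => x r r0; have [y [Dy xy]] := dD x r r0.
  by have [n _ qn] := @surj _ _ _ _ q y Dy; exists n; rewrite qn.
apply: (measurability _ (RGenInftyO.measurableE R)) => _ [_ [r ->] <-].
rewrite setTI (_ : _ @^-1` _ =
    \bigcup_n [set z : E * E | dist z.1 (q n) + dist z.2 (q n) < r]).
  apply: bigcupT_measurable => n; rewrite -[X in measurable X]setTI.
  have -> : [set z : E * E | dist z.1 (q n) + dist z.2 (q n) < r] =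
      (fun z : E * E => dist z.1 (q n) + dist z.2 (q n)) @^-1` `]-oo, r[.
    by apply/seteqP; split => z /=; rewrite in_itv.
  apply: (measurable_funD _ _ measurableT) => //.
    by apply: (measurableT_comp (measurable_distl _)); exact: measurable_fst.
  by apply: (measurableT_comp (measurable_distl _)); exact: measurable_snd.
apply/seteqP; split => [[x y]|[x y] [n _]] /=; rewrite in_itv/=.
  move=> xyr; have [|n hn] := qD x ((r - dist x y) / 2); first lra.
  by exists n => //=; have := dist_triangle x y (q n); rewrite (distC y x); lra.
by have := dist_triangle (q n) x y; rewrite (distC (q n) y); lra.
Qed.

Lemma measurable_fun_dist d (T : measurableType d) (f g : T -> E) :
  measurable_fun setT f -> measurable_fun setT g ->
  measurable_fun setT (fun t => dist (f t) (g t)).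
Proof.
move=> mf mg; apply: (measurableT_comp measurable_dist (g := fun t => (f t, g t))).
exact: measurable_fun_pair.
Qed.

(** The tolerances [k.+1%:R^-1] stand for all positive reals, so that the set of parameters with a
    Cauchy sequence is a countable combination of measurable sets. *)
Definition mcauchy (u : nat -> E) := forall k : nat, exists N, forall m n,
  (N <= m)%N -> (N <= n)%N -> dist (u m) (u n) < k.+1%:R^-1.

Definition mcvg (u : nat -> E) (l : E) := forall eps, 0 < eps ->
  exists N, forall n, (N <= n)%N -> dist (u n) l < eps.

(** The default [x0] makes the limit total, hence measurable in a parameter with no exceptional null
    set. *)
Definition mlim (x0 : E) (u : nat -> E) : E :=
  if `[< mcauchy u >] then xget x0 [set l | mcvg u l] else x0.

Lemma invSn_lt (eps : R) : 0 < eps -> exists k : nat, k.+1%:R^-1 < eps.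
Proof.
move=> e0; exists (Num.bound eps^-1).
rewrite invf_plt ?posrE//; apply: (lt_trans (archi_boundP _)).
  by rewrite invr_ge0 ltW.
by rewrite ltr_nat.
Qed.

Lemma mcvg_mlim x0 u : mcauchy u -> mcvg u (mlim x0 u).
Proof.
move=> cu; rewrite /mlim asboolT//; apply: xgetPex.
have [_ mc _ _] := HE; apply: mc => eps e0.
have [k ke] := invSn_lt e0; have [N NP] := cu k.
by exists N => m n Nm Nn; exact: lt_trans (NP _ _ Nm Nn) ke.
Qed.

Lemma measurable_mlim d (T : measurableType d) x0 (u : nat -> T -> E) :
  (forall n, measurable_fun setT (u n)) ->
  measurable_fun setT (fun t => mlim x0 (u ^~ t)).
Proof.
move=> mu; have [_ _ _ mE] := HE.
have mlt (m n k : nat) : measurable [set t | dist (u m t) (u n t) < k.+1%:R^-1].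
  have -> : [set t | dist (u m t) (u n t) < k.+1%:R^-1] =
      (fun t => dist (u m t) (u n t)) @^-1` `]-oo, k.+1%:R^-1[.
    by apply/seteqP; split => z /=; rewrite in_itv.
  rewrite -[X in measurable X]setTI.
  by apply: (measurable_fun_dist _ _ measurableT) => //; exact: mu.
have mC : measurable [set t | mcauchy (u ^~ t)].
  have -> : [set t | mcauchy (u ^~ t)] = \bigcap_k \bigcup_N
      \bigcap_(m in [set m | (N <= m)%N]) \bigcap_(n in [set n | (N <= n)%N])
      [set t | dist (u m t) (u n t) < k.+1%:R^-1].
    apply/seteqP; split => t.
      by move=> ct k _; have [N NP] := ct k; exists N => // m /= Nm n /= Nn; exact: NP.
    by move=> ct k; have [N _ NP] := ct k I; exists N => m n Nm Nn; exact: NP.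
  apply: bigcapT_measurable => k; apply: bigcupT_measurable => N.
  apply: bigcap_measurable; first by exists N => /=.
  move=> m _; apply: bigcap_measurable; first by exists N => /=.
  by move=> n _; exact: mlt.
apply: (measurability _ mE) => _ [U oU <-]; rewrite setTI.
pose W k := [set y | forall v, dist y v < k.+1%:R^-1 -> U v].
have mW k : measurable (W k).
  rewrite -[W k]setCK; apply: measurableC; apply: metric_open_measurable => y.
  move=> /existsNP[v /not_implyP[yv nUv]].
  exists (k.+1%:R^-1 - dist y v); split; first by rewrite subr_gt0.
  move=> z yz Wz; apply: nUv; apply: Wz.
  have := dist_triangle y z v; rewrite (distC z y).
  by move: yz; move: (k.+1%:R^-1) => e; lra.
have -> : (fun t => mlim x0 (u ^~ t)) @^-1` U =
   ([set t | mcauchy (u ^~ t)] `&`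
     \bigcup_k \bigcup_N \bigcap_(n in [set n | (N <= n)%N]) (u n @^-1` W k))
   `|` (~` [set t | mcauchy (u ^~ t)] `&` [set t | U x0]).
  apply/seteqP; split => t /=.
    have [ct Ut|ct] := pselect (mcauchy (u ^~ t)); last first.
      by rewrite /mlim asboolF// => Ux0; right.
    left; split => //; have [r [r0 rU]] := oU _ Ut.
    have [|k kr] := @invSn_lt (r / 2); first lra.
    have [N NP] := mcvg_mlim x0 ct (ltac:(lra) : 0 < r / 2).
    exists k => //; exists N => // n /= Nn v vk; apply: rU.
    have := dist_triangle (u n t) (mlim x0 (u ^~ t)) v.
    rewrite (distC _ (u n t)); have /= := NP _ Nn.
    by move: kr vk; move: (k.+1%:R^-1) => e; lra.
  move=> [[ct [k _ [N _ NP]]]|[ct Ux0]]; last by rewrite /mlim asboolF.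
  have [M MP] := mcvg_mlim x0 ct (ltac:(by rewrite invr_gt0) : 0 < k.+1%:R^-1 :> R).
  apply: (NP (maxn N M)); first by rewrite /= leq_maxl.
  by apply: MP; rewrite leq_maxr.
apply: measurableU.
  apply: measurableI => //; apply: bigcupT_measurable => k.
  apply: bigcupT_measurable => N; apply: bigcap_measurable; first by exists N => /=.
  by move=> n _; rewrite -[X in measurable X]setTI; exact: (mu n measurableT).
apply: measurableI; first exact: measurableC.
have [Ux0|nU] := pselect (U x0).
  by rewrite (_ : mkset _ = setT); [exact: measurableT|apply/seteqP; split].
by rewrite (_ : mkset _ = set0); [exact: measurable0|apply/seteqP; split].
Qed.

End Polish.

(** * Path spaces and shifts *)

Lemma setI_closed_measure_eq (R : realType) d (T : measurableType d)
    (G : set (set T)) (m1 m2 : {measure set T -> \bar R}) :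
  measurable = <<s G >> -> setI_closed G -> G setT ->
  (m1 setT < +oo)%E -> (forall A, G A -> m1 A = m2 A) ->
  forall A, measurable A -> m1 A = m2 A.
Proof.
move=> mG GI GT m1oo m12 A mA.
apply: (measure_unique G (fun _ => setT)) => //.
by apply/seteqP; split => // x _; exists 0%N.
Qed.

Notation pathType T := (g_sigma_algebraType (@cylinders _ T)).

Section Paths.
Context d (T : measurableType d).

Lemma measurable_path_eval (t : int) :
  measurable_fun setT (fun w : pathType T => w t).
Proof.
move=> _ A mA; rewrite setTI; apply: sub_sigma_algebra.
by exists t, A.
Qed.

Lemma measurable_fun_path d' (S : measurableType d') (f : S -> int -> T) :
  (forall t, measurable_fun setT (fun x => f x t)) ->
  measurable_fun setT (f : S -> pathType T).
Proof.
move=> mf; apply: (@measurability _ _ _ (pathType T) _ _ (@cylinders _ T)) => // _ [_ [t [A [mA ->]]] <-].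
by apply: mf.
Qed.

Definition shiftn (t : int) (w : int -> T) : int -> T := fun j => w (j + t).

Lemma shiftnE : @Defs.shift T = shiftn 1. Proof. by []. Qed.

Lemma shiftnD s t w : shiftn s (shiftn t w) = shiftn (s + t) w.
Proof. by apply/funext => j; rewrite /shiftn addrA. Qed.

Lemma shiftn0 w : shiftn 0 w = w.
Proof. by apply/funext => j; rewrite /shiftn addr0. Qed.

Lemma measurable_shiftn t :
  measurable_fun setT (shiftn t : pathType T -> pathType T).
Proof. by apply: measurable_fun_path => s; exact: measurable_path_eval. Qed.

Definition fincyl (s : seq int) (A : int -> set T) : set (int -> T) :=
  [set w | forall t, t \in s -> A t (w t)].

(** A pi-system; [J] is [setT] when it generates the path space and [[set j | j <= t]] when it
    describes the noise up to [t]. The list is free of duplicates because [mutually_independent]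
    takes such lists. *)
Definition fincyls (J : set int) : set (set (int -> T)) :=
  [set C | exists s A, [/\ uniq s, (forall t, t \in s -> J t),
     (forall t, measurable (A t)) & C = fincyl s A]].

Lemma fincyls_setT J : fincyls J setT.
Proof.
exists [::], (fun=> setT); split => //.
by apply/seteqP; split.
Qed.

Lemma fincyls_setI J : setI_closed (fincyls J).
Proof.
move=> _ _ [s [A [us sJ mA ->]]] [s' [A' [us' sJ' mA' ->]]].
exists (undup (s ++ s')), (fun t => (if t \in s then A t else setT) `&`
  (if t \in s' then A' t else setT)); split.
- exact: undup_uniq.
- by move=> t; rewrite mem_undup mem_cat => /orP[/sJ|/sJ'].
- by move=> t; apply: measurableI; case: ifP.
- apply/seteqP; split => w.
    move=> [ws ws'] t _; split; case: ifPn => // H; [exact: ws|exact: ws'].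
  move=> h; split => t ts.
    by have := h t; rewrite mem_undup mem_cat ts => -[]//.
  by have := h t; rewrite mem_undup mem_cat ts orbT => -[].
Qed.

Lemma measurable_fincyl s A : (forall t, measurable (A t)) ->
  measurable (fincyl s A : set (pathType T)).
Proof.
move=> mA; have -> : fincyl s A = \bigcap_(t in [set` s]) [set w | A t (w t)].
  by apply/seteqP; split.
apply: fin_bigcap_measurable => [|t _]; first exact: finite_seq.
rewrite -[X in measurable X]setTI.
by apply: measurable_path_eval.
Qed.

Lemma path_measurable_fincyls :
  (measurable : set (set (pathType T))) = <<s fincyls setT >>.
Proof.
apply/seteqP; split; apply: smallest_sub.
- exact: smallest_sigma_algebra.
- move=> _ [t [A [mA ->]]]; apply: sub_sigma_algebra.
  exists [:: t], (fun=> A); split => //.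
  apply/seteqP; split => w /=.
    by move=> Aw s; rewrite inE => /eqP ->.
  by apply; rewrite inE.
- exact: smallest_sigma_algebra.
- by move=> _ [s [A [_ _ mA ->]]]; exact: measurable_fincyl.
Qed.

End Paths.

Section PathRV.
Context (R : realType) dO (Omega : measurableType dO) (P : probability Omega R).
Context d (T : measurableType d).
Variable Y : int -> {mfun Omega >-> T}.

Definition pathRV (w : Omega) : pathType T := fun t => Y t w.

Lemma measurable_pathRV : measurable_fun setT pathRV.
Proof. by apply: measurable_fun_path => t; exact: measurable_funPT. Qed.

HB.instance Definition _ := isMeasurableFun.Build _ _ _ _ pathRV measurable_pathRV.

Lemma sigma_gen_pathRV (B : set (int -> T)) : path_measurable B ->
  sigma_gen (fun t w => Y t w) setT (pathRV @^-1` B).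
Proof.
move=> mB.
have : measurable_fun setT (pathRV : g_sigma_algebraType
   [set B | exists i, [set: int] i /\ exists A, measurable A /\ B = Y i @^-1` A] -> pathType T).
  apply: measurable_fun_path => t _ A mA; rewrite setTI.
  by apply: sub_sigma_algebra; exists t; split => //; exists A.
by move=> /(_ measurableT _ mB); rewrite setTI.
Qed.

(** Events generated by the process are to be shifted in time, which makes sense for sets of paths
    and not for subsets of [Omega]. *)
Lemma sigma_gen_path (J : set int) (C : set Omega) :
  sigma_gen (fun t w => Y t w) J C ->
  exists2 B, path_measurable B & C = pathRV @^-1` B.
Proof.
have : sigma_gen (fun t w => Y t w) J `<=`
    preimage_set_system setT pathRV (@path_measurable _ T).
  apply: smallest_sub.
    by apply: sigma_algebra_preimage; exact: smallest_sigma_algebra.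
  move=> _ [i [_ [A [mA ->]]]]; exists [set w | A (w i)]; last by rewrite setTI.
  by apply: sub_sigma_algebra; exists i, A.
by move=> H /H [B mB <-]; exists B => //; rewrite setTI.
Qed.

Lemma sigma_gen_measurable (J : set int) (C : set Omega) :
  sigma_gen (fun t w => Y t w) J C -> measurable C.
Proof.
move=> /sigma_gen_path[B mB ->]; rewrite -[X in measurable X]setTI.
exact: measurable_pathRV.
Qed.

Definition path_law := distribution P pathRV.
HB.instance Definition _ := Probability.on path_law.

Hypothesis Hst : stationary P (fun t w => Y t w).

Lemma stationary_shift_law (B : set (pathType T)) : measurable B ->
  path_law (shiftn 1 @^-1` B) = path_law B.
Proof. by move=> mB; exact: Hst. Qed.

Lemma stationary_shiftn_law (t : int) (B : set (pathType T)) : measurable B ->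
  path_law (shiftn t @^-1` B) = path_law B.
Proof.
have shiftnN n (C : set (pathType T)) : measurable C ->
    path_law (shiftn n%:Z @^-1` C) = path_law C.
  elim: n C => [|n IH] C mC.
    by congr (path_law _); apply/seteqP; split => w; rewrite /preimage/= shiftn0.
  rewrite -[RHS]IH// -[RHS]stationary_shift_law; last first.
    by rewrite -[X in measurable X]setTI; exact: measurable_shiftn.
  congr (path_law _); apply/seteqP; split => w; rewrite /preimage/= shiftnD;
    by rewrite -[n.+1]addn1 PoszD.
move=> mB; case: t => n; first exact: shiftnN.
(* For a negative shift, invariance under the opposite positive shift is applied to the preimage,
   and the two shifts cancel. *)
rewrite NegzE -[LHS](shiftnN n.+1); last first.
  by rewrite -[X in measurable X]setTI; exact: measurable_shiftn.
by congr (path_law _); apply/seteqP; split => w;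
  rewrite /preimage/= shiftnD addNr shiftn0.
Qed.

Lemma stationary_shiftn (t : int) (B : set (int -> T)) : path_measurable B ->
  P [set w | B (shiftn t (pathRV w))] = P [set w | B (pathRV w)].
Proof. exact: stationary_shiftn_law. Qed.

(** Statements about the environment seen from time 0 are proved once under [path_law] and read off
    at any time [t] through this lemma. *)
Lemma ae_path_shiftn (t : int) (Q : set (int -> T)) :
  {ae path_law, forall z, Q z} -> {ae P, forall w, Q (shiftn t (pathRV w))}.
Proof.
move=> [N [mN N0 NQ]]; exists [set w | N (shiftn t (pathRV w))]; split.
- rewrite -[X in measurable X]setTI.
  by apply: (measurableT_comp (@measurable_shiftn _ _ t) measurable_pathRV).
- by rewrite stationary_shiftn.
- by move=> w nQ; apply: NQ.
Qed.

End PathRV.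

(** * The maximal ergodic lemma *)

Section MaximalErgodic.
Context (R : realType) d (T : measurableType d) (mu : probability T R).
Variable tau : T -> T.
Hypothesis mtau : measurable_fun setT tau.
Hypothesis tau_inv : forall A, measurable A -> mu (tau @^-1` A) = mu A.
Variable g : T -> R.
Hypothesis ig : mu.-integrable setT (EFin \o g).

Let mg : measurable_fun setT g.
Proof. by apply/measurable_EFinP; exact: measurable_int ig. Qed.

Lemma ge0_integral_invariant (f : T -> \bar R) : measurable_fun setT f ->
  (forall x, (0 <= f x)%E) -> (\int[mu]_x f (tau x) = \int[mu]_x f x)%E.
Proof.
move=> mf f0.
have := ge0_integral_pushforward mtau mu measurableT mf (fun x _ => f0 x).
rewrite preimage_setT => <-.
apply: eq_measure_integral => A mA _; exact: tau_inv.
Qed.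

Lemma integrable_invariant (f : T -> R) : mu.-integrable setT (EFin \o f) ->
  mu.-integrable setT (EFin \o (f \o tau)).
Proof.
move=> /integrableP[mf foo]; apply/integrableP; split.
  exact: (measurableT_comp mf).
rewrite (ge0_integral_invariant (f := fun x => `|(EFin \o f) x|%E))//.
exact: measurableT_comp.
Qed.

Fixpoint bsum (n : nat) (x : T) : R :=
  if n is m.+1 then g x + bsum m (tau x) else 0.

(** The maximum of [bsum 0 x], ..., [bsum n x]; in recursive form, the identity behind Garsia's
    argument is the definition itself. *)
Fixpoint bmax (n : nat) (x : T) : R :=
  if n is m.+1 then Num.max 0 (g x + bmax m (tau x)) else 0.

Lemma measurable_bsum n : measurable_fun setT (bsum n).
Proof.
elim: n => [|n IH] /=; first exact: measurable_cst.
by apply: measurable_funD => //; exact: measurableT_comp.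
Qed.

Lemma measurable_bmax n : measurable_fun setT (bmax n).
Proof.
elim: n => [|n IH] /=; first exact: measurable_cst.
apply: measurable_maxr; first exact: measurable_cst.
by apply: measurable_funD => //; exact: measurableT_comp.
Qed.

Lemma bmax_ge0 n x : 0 <= bmax n x.
Proof. by case: n => [|n] //=; rewrite le_max lexx. Qed.

Lemma bsum_le_bmax n x : bsum n x <= bmax n x.
Proof. by elim: n x => [|n IH] x //=; rewrite le_max lerD2l IH orbT. Qed.

Lemma bmaxS n x : bmax n x <= bmax n.+1 x.
Proof.
elim: n x => [|n IH] x; first exact: bmax_ge0.
rewrite [bmax n.+1 x]/= [bmax n.+2 x]/= ge_max le_max lexx/=.
by rewrite le_max lerD2l IH orbT.
Qed.

Lemma le_bmax m n x : (m <= n)%N -> bmax m x <= bmax n x.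
Proof.
move=> /subnK <-; elim: (n - m)%N => [|k IH] //.
by rewrite addSn; exact: le_trans IH (bmaxS _ _).
Qed.

Lemma integrable_bmax n : mu.-integrable setT (EFin \o bmax n).
Proof.
elim: n => [|n IH]; first exact: integrable0.
have iD := integrableD measurableT ig (integrable_invariant IH).
apply: (le_integrable measurableT _ _ iD).
  by apply/measurable_EFinP; exact: measurable_bmax.
move=> x _; rewrite lee_fin ger0_norm; last by rewrite le_max lexx.
by rewrite ge_max normr_ge0/= ler_norm.
Qed.

(* Garsia's argument: max(-bmax n o tau, g) = bmax n.+1 - bmax n o tau has a
   nonnegative integral and tends to g. *)
Lemma maximal_ergodic :
  {ae mu, forall x, exists n, - g x <= bmax n (tau x)} ->
  (0 <= \int[mu]_x (g x)%:E)%E.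
Proof.
move=> aeg.
pose h n x := (Num.max (- bmax n (tau x)) (g x))%:E.
have mh n : measurable_fun setT (h n).
  apply/measurable_EFinP; apply: measurable_maxr => //.
  apply: measurable_funN; exact: (measurableT_comp (measurable_bmax n)).
have hE n x : h n x = ((bmax n.+1 x)%:E - (bmax n (tau x))%:E)%E.
  rewrite /h -EFinB; congr EFin; rewrite /=; case: leP => h1; case: leP => h2; lra.
have h_ge0 n : (0 <= \int[mu]_x h n x)%E.
  under eq_integral do rewrite hE.
  rewrite integralB//=; [|exact: (integrable_bmax n.+1)|
    exact: (integrable_invariant (integrable_bmax n))].
  rewrite (ge0_integral_invariant (f := fun x => (bmax n x)%:E)); last 2 first.
  - by apply/measurable_EFinP; exact: measurable_bmax.
  - by move=> x; rewrite lee_fin bmax_ge0.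
  rewrite sube_ge0; last first.
    by rewrite [X in _ || X](integrable_fin_num measurableT (integrable_bmax n.+1)) orbT.
  apply: ge0_le_integral => //.
  - by move=> x _; rewrite lee_fin bmax_ge0.
  - by apply/measurable_EFinP; exact: measurable_bmax.
  - by apply/measurable_EFinP; exact: (measurable_bmax n.+1).
  - by move=> x _; rewrite lee_fin; exact: bmaxS.
have [] := @dominated_convergence _ _ _ mu setT measurableT h (EFin \o g)
  (fun x => `|(g x)%:E|%E) mh _ _ _ _.
- exact/measurable_EFinP.
- apply: filterS aeg => x [N hN] _.
  apply: cvg_near_cst; near=> n; rewrite /h/=; congr EFin.
  apply: max_idPr; rewrite lerNl; apply: le_trans hN _; apply: le_bmax.
  by near: n; exact: nbhs_infty_ge.
- exact: integrable_abse.
- apply: aeW => x n _; rewrite /h/= lee_fin.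
  have b0 := bmax_ge0 n (tau x); have [h1|h1] := leP (- bmax n (tau x)) (g x) => //.
  by rewrite !ler0_norm; lra.
move=> _ _ hg; have := cvg_lim (@ereal_hausdorff R) hg => <-.
by apply: lime_ge; [apply/cvg_ex; eexists; exact: hg|exact: nearW].
Unshelve. all: by end_near. Qed.

Hypothesis tau_erg : forall A, measurable A -> tau @^-1` A = A ->
  mu A = 0%E \/ mu A = 1%E.

(** The event [A] of sums unbounded above is exactly invariant, since dropping the first term [g x]
    changes nothing. If it had measure 1, some sum would be positive almost everywhere, and the
    maximal lemma would give [g] a nonnegative integral. *)
Lemma ergodic_bsum_bounded : (\int[mu]_x (g x)%:E < 0)%E ->
  {ae mu, forall x, exists C, forall n, bsum n x <= C}.
Proof.
move=> gneg.
pose A := \bigcap_(k : nat) \bigcup_n [set x | k%:R < bsum n x].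
have AP x : A x <-> forall C, exists n, C < bsum n x.
  split=> [Ax C|Ax k _]; last by have [n hn] := Ax k%:R; exists n.
  have [n _ hn] := Ax (Num.bound `|C|) I; exists n.
  apply: le_lt_trans hn; apply: le_trans (ler_norm _) _.
  exact/ltW/archi_boundP.
have mA : measurable A.
  apply: bigcapT_measurable => k; apply: bigcupT_measurable => n.
  rewrite (_ : mkset _ = bsum n @^-1` `]k%:R, +oo[); last first.
    by apply/seteqP; split => x /=; rewrite in_itv/= andbT.
  by rewrite -[X in measurable X]setTI; exact: measurable_bsum.
have [|A0|A1] := @tau_erg A mA.
- apply/seteqP; split => x /=.
    move=> /AP H; apply/AP => C; have [n hn] := H (C - g x).
    by exists n.+1; rewrite /=; lra.
  move=> /AP H; apply/AP => C.
  (* The maximum with 0 excludes the empty sum, so there is a first term to drop. *)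
  have [[|n] hn] := H (Num.max 0 (g x + C)); first by move: hn; rewrite /= gt_max ltxx.
  by exists n; move: hn; rewrite /= gt_max => /andP[_]; lra.
- exists A; split => // x nC; apply/AP => C; apply: contrapT => nn.
  by apply: nC; exists C => n; rewrite leNgt; apply/negP => hn; apply: nn; exists n.
- exfalso; move: gneg; apply/negP; rewrite -leNgt; apply: maximal_ergodic.
  exists (~` A); split; first exact: measurableC.
    by rewrite probability_setC// A1 subee.
  move=> x; apply: contra_not => Ax; have /AP/(_ 0)[[|n] hn] := Ax.
    by move: hn; rewrite /= ltxx.
  by exists n; move: hn; rewrite /=; have := bsum_le_bmax n (tau x); lra.
Qed.

End MaximalErgodic.

(** * Exponential decay along the environment *)

Lemma prob_integral_cst (R : realType) d (T : measurableType d)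
  (P : probability T R) (r : R) : (\int[P]_w r%:E = r%:E)%E.
Proof.
rewrite integral_cst// [X in (_ * X)%E](_ : _ = 1%E) ?mule1//.
exact: probability_setT.
Qed.

Lemma integral_shiftn_path (R : realType) dO (Omega : measurableType dO)
    (P : probability Omega R) d (T : measurableType d)
    (Y : int -> {mfun Omega >-> T}) (s : int) (f : pathType T -> \bar R) :
  stationary P (fun t w => Y t w) -> measurable_fun setT f ->
  (forall y, 0 <= f y)%E ->
  (\int[P]_w f (shiftn s (pathRV Y w)) = \int[P]_w f (pathRV Y w))%E.
Proof.
move=> Yst mf f0.
have := @ge0_integral_invariant _ _ _ (path_law P Y) (shiftn s)
  (@measurable_shiftn _ _ s) (@stationary_shiftn_law _ _ _ P _ _ Y Yst s) f mf f0.
rewrite /path_law ge0_integral_distribution//; last first.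
  exact: (measurableT_comp mf (@measurable_shiftn _ _ s)).
by rewrite ge0_integral_distribution.
Qed.

Section Decay.
Context (R : realType) dO (Omega : measurableType dO) (P : probability Omega R).
Context d (T : measurableType d).
Variable Z : int -> {mfun Omega >-> T}.
Hypothesis HZstat : stationary P (fun t w => Z t w).
Hypothesis HZerg : ergodic P (fun t w => Z t w).

Lemma ergodic_sums_bounded (G : T -> R) : measurable_fun setT G ->
  P.-integrable setT (fun w => (G (Z 0 w))%:E) ->
  (\int[P]_w (G (Z 0 w))%:E < 0)%E ->
  {ae path_law P Z, forall z, exists C, forall n : nat,
    \sum_(i < n) G (z (- i%:Z)) <= C}.
Proof.
move=> mG iG Gneg.
pose g (z : pathType T) := G (z 0).
have mg : measurable_fun setT g by exact: (measurableT_comp mG (@measurable_path_eval _ T 0)).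
have ig : (path_law P Z).-integrable setT (EFin \o g).
  apply/integrableP; split; first exact/measurable_EFinP.
  move/integrableP : iG => [_]; congr (_ < _)%E.
  rewrite /path_law ge0_integral_distribution//.
  by apply: measurableT_comp => //; exact/measurable_EFinP.
have := @ergodic_bsum_bounded _ _ _ (path_law P Z) (shiftn (-1))
  (@measurable_shiftn _ T _) (@stationary_shiftn_law _ _ _ _ _ _ _ HZstat (-1)) g ig.
have bsumE z n : @bsum R _ (pathType T) (shiftn (-1)) g n z = \sum_(i < n) G (z (- i%:Z)).
  elim: n z => [|n IH] z; first by rewrite big_ord0.
  rewrite big_ord_recl /= IH oppr0; congr (_ + _); apply: eq_bigr => i _.
  by rewrite /shiftn; congr (G (z _)); rewrite /bump /=; lia.
move=> H; apply: (filterS _ (H _ _)).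
- by move=> z [C hC]; exists C => n; rewrite -bsumE.
(* The sums run into the past, so the map is the backward shift; a set invariant under it is
   invariant under the forward shift, in which [ergodic] is phrased. *)
- move=> A mA AE; apply: HZerg => //; apply/funext => z.
  have AEz y : A (shiftn (-1) y) = A y by exact: (congr1 (@^~ y) AE).
  by change (A (shiftn 1 z) = A z); rewrite -(AEz (shiftn 1 z)) shiftnD addNr shiftn0.
- by rewrite /path_law integral_distribution//; exact/measurable_EFinP.
Qed.

(** A single term is the difference of two consecutive partial sums. Boundedness for
    [h - m - eta / 2] bounds the longer sum from above, boundedness for [- h + m - eta / 2] bounds
    the shorter one from below, and the drifts [n * m] cancel. *)
Lemma ergodic_growth (h : T -> R) (eta : R) : measurable_fun setT h -> 0 < eta ->
  P.-integrable setT (fun w => (h (Z 0 w))%:E) ->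
  {ae path_law P Z, forall z, exists C, forall n : nat,
    h (z (- n%:Z)) <= C + eta * n%:R}.
Proof.
move=> mh eta0 ih.
have ic c : P.-integrable setT (fun=> c%:E) by exact: finite_measure_integrable_cst.
have ioo := integrable_fin_num measurableT ih.
pose m := fine (\int[P]_w (h (Z 0 w))%:E)%E.
have mE : (\int[P]_w (h (Z 0 w))%:E)%E = m%:E by rewrite fineK.
have H1 := @ergodic_sums_bounded (fun x => h x + (- m - eta / 2)) _ _ _.
have H2 := @ergodic_sums_bounded (fun x => - h x + (m - eta / 2)) _ _ _.
have {}H1 := H1 (measurable_funD mh (measurable_cst _))
  (integrableD measurableT ih (ic _)).
have {}H2 := H2 (measurable_funD (measurable_funN mh) (measurable_cst _))
  (integrableD measurableT (integrableN ih) (ic _)).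
have I1 : (\int[P]_w (h (Z 0 w) + (- m - eta / 2))%:E < 0)%E.
  under eq_integral do rewrite EFinD.
  rewrite (integralD measurableT ih (ic _)) mE prob_integral_cst.
  by rewrite -EFinD lte_fin; lra.
have I2 : (\int[P]_w (- h (Z 0 w) + (m - eta / 2))%:E < 0)%E.
  under eq_integral do rewrite EFinD EFinN.
  rewrite (integralD measurableT (integrableN ih) (ic _)) integralN; last first.
    exact: integrable_add_def ih.
  rewrite mE prob_integral_cst.
  by rewrite -EFinN -EFinD lte_fin; lra.
apply: (@filterS2 _ _ (ae_filter_ringOfSetsType _) _ _ _ _ (H1 I1) (H2 I2)).
move=> z [C1 h1] [C2 h2].
exists (C1 + C2 + m + eta / 2) => n.
have sumE (f : nat -> R) a N : \sum_(i < N) (f i + a) = \sum_(i < N) f i + N%:R * a.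
  by rewrite big_split/= sumr_const card_ord mulr_natl.
have := h1 n.+1; have := h2 n.
rewrite (sumE (fun i => - h (z (- i%:Z)))) (sumE (fun i => h (z (- i%:Z)))) sumrN.
rewrite big_ord_recr/= -(natr1 n).
have -> : (n%:R + 1) * (- m - eta / 2) = - (n%:R * m) - (eta * n%:R) / 2 - m - eta / 2.
  by ring.
have -> : n%:R * (m - eta / 2) = n%:R * m - (eta * n%:R) / 2 by ring.
by move: (n%:R * m) (eta * n%:R) => a b; lra.
Qed.

Lemma logpE (x : R) : 0 < x -> logp x = Num.max (ln x) 0.
Proof.
move=> x0; rewrite /logp; case: ifPn => [x1|].
  by rewrite max_l// ln_ge0.
by rewrite -ltNge => x1; rewrite max_r// ltW// ln_lt0// x0.
Qed.

(** The integral of [f] may be [-oo], whereas the maximal lemma needs an integrable function. The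
    truncated negative parts min(f^-, M) increase to f^-, so by monotone convergence one of them
    already has a larger integral than f^+. *)
Lemma integral_truncation_lt0 (f : Omega -> R) : measurable_fun setT f ->
  (\int[P]_w (Num.max (f w) 0)%:E < +oo)%E -> (\int[P]_w (f w)%:E < 0)%E ->
  exists M : nat, P.-integrable setT (fun w => (Num.max (f w) (- M%:R))%:E) /\
    (\int[P]_w (Num.max (f w) (- M%:R))%:E < 0)%E.
Proof.
move=> mf fpoo fneg.
pose fn w := Num.max (- f w) 0.
pose tr (M : nat) w := Num.min (fn w) M%:R.
have mfn : measurable_fun setT fn by apply: measurable_maxr => //; exact: measurable_funN.
have mtr M : measurable_fun setT (tr M) by exact: measurable_minr.
have tr0 M w : 0 <= tr M w by rewrite /tr /fn le_min le_max lexx orbT/=.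
have trE M w : Num.max (f w) (- M%:R) = Num.max (f w) 0 - tr M w.
  rewrite /tr /fn; have M0 := ler0n R M; have [f0|f0] := lerP 0 (f w).
    rewrite max_l; last lra.
    by rewrite [Num.max (- f w) 0]max_r ?min_l//; lra.
  rewrite [Num.max (- f w) 0]max_l; last lra.
  have [h|h] := lerP (f w) (- M%:R); first by rewrite min_r; lra.
  by rewrite min_l; lra.
have ltpn : (\int[P]_w (Num.max (f w) 0)%:E < \int[P]_w (fn w)%:E)%E.
  move: fneg; rewrite integralE.
  under eq_integral do rewrite funeposE -EFin_max.
  under [X in (_ - X)%E]eq_integral do rewrite funenegE -EFinN -EFin_max.
  by rewrite sube_lt0// ge0_fin_numE ?fpoo// integral_ge0// => w _;
    rewrite lee_fin le_max lexx orbT.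
have cvtr : (\int[P]_w (tr M w)%:E @[M --> \oo] --> \int[P]_w (fn w)%:E)%E.
  have -> : (fun w => (fn w)%:E) = (fun w => limn (fun M => (tr M w)%:E)).
    apply/funext => w; apply/esym/cvg_lim => //; apply: cvg_near_cst; near=> M.
    congr EFin; rewrite /tr min_l//.
    apply/ltW; apply: (lt_le_trans (archi_boundP _)).
      by rewrite /fn le_max lexx orbT.
    by rewrite ler_nat; near: M; exact: nbhs_infty_ge.
  apply: cvg_monotone_convergence => //.
  - by move=> n; exact/measurable_EFinP.
  - by move=> n w _; rewrite lee_fin.
  - move=> w _ a b ab; rewrite lee_fin /tr.
    by rewrite le_min !ge_min lexx/= ler_nat ab orbT.
have [M hM] : exists M, (\int[P]_w (Num.max (f w) 0)%:E < \int[P]_w (tr M w)%:E)%E.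
  apply: contrapT => /forallNP nM; move: ltpn; apply/negP; rewrite -leNgt.
  rewrite -(cvg_lim (@ereal_hausdorff R) cvtr); apply: lime_le.
    by apply/cvg_ex; eexists; exact: cvtr.
  by apply: nearW => M; rewrite leNgt; apply/negP/nM.
have ip : P.-integrable setT (fun w => (Num.max (f w) 0)%:E).
  apply/integrableP; split; first by apply/measurable_EFinP; exact: measurable_maxr.
  by under eq_integral do rewrite gee0_abs ?lee_fin ?le_max ?lexx ?orbT//.
have it : P.-integrable setT (fun w => (tr M w)%:E).
  have iM : P.-integrable setT (fun=> M%:R%:E) by exact: finite_measure_integrable_cst.
  apply: (le_integrable measurableT _ _ iM).
    exact/measurable_EFinP.
  by move=> w _; rewrite lee_fin !ger0_norm// ge_min lexx orbT.
exists M; split.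
  have -> : (fun w => (Num.max (f w) (- M%:R))%:E) =
     (fun w => (Num.max (f w) 0)%:E - (tr M w)%:E)%E.
    by apply/funext => w; rewrite trE EFinB.
  exact: integrableB.
under eq_integral do rewrite trE EFinB.
rewrite integralB//= sube_lt0// (integrable_fin_num measurableT ip)//.
Unshelve. all: by end_near. Qed.

Lemma ergodic_product_decay (kappa : T -> R) : measurable_fun setT kappa ->
  (forall x, 0 < kappa x) ->
  (\int[P]_w (logp (kappa (Z 0 w)))%:E < +oo)%E ->
  (\int[P]_w (ln (kappa (Z 0 w)))%:E < 0)%E ->
  exists delta, 0 < delta /\
  {ae path_law P Z, forall z, exists C, 0 < C /\ forall n : nat,
    \prod_(i < n) kappa (z (- i%:Z)) <= C * expR (- delta * n%:R)}.
Proof.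
move=> mk k0 kp kn.
have mlk : measurable_fun setT (fun x => ln (kappa x)).
  exact: (measurableT_comp (@measurable_ln R)).
have [||M [iM Mneg]] := @integral_truncation_lt0 (fun w => ln (kappa (Z 0 w))) _ _ kn.
- exact: (measurableT_comp mlk).
- by under eq_integral do rewrite -logpE//.
pose m := fine (\int[P]_w (Num.max (ln (kappa (Z 0 w))) (- M%:R))%:E)%E.
have mE : (\int[P]_w (Num.max (ln (kappa (Z 0 w))) (- M%:R))%:E)%E = m%:E.
  by rewrite fineK// (integrable_fin_num measurableT iM).
have m0 : m < 0 by rewrite -lte_fin -mE.
have ic c : P.-integrable setT (fun=> c%:E) by exact: finite_measure_integrable_cst.
(* Subtracting [m / 2] leaves the negative mean [m / 2], so the shifted sums stay bounded above, and
   the subtracted half of the drift is the decay rate. *)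
exists (- m / 2); split; first lra.
have := @ergodic_sums_bounded (fun x => Num.max (ln (kappa x)) (- M%:R) - m / 2).
have mmax : measurable_fun setT (fun x => Num.max (ln (kappa x)) (- M%:R)).
  by apply: measurable_maxr => //; exact: measurable_cst.
move=> /(_ (measurable_funD mmax (measurable_cst _))
  (integrableD measurableT iM (ic _))) H.
have I : (\int[P]_w (Num.max (ln (kappa (Z 0 w))) (- M%:R) - m / 2)%:E < 0)%E.
  under eq_integral do rewrite EFinD.
  rewrite (integralD measurableT iM (ic _)) mE prob_integral_cst.
  by rewrite -EFinD lte_fin; lra.
apply: (@filterS _ _ (ae_filter_ringOfSetsType _) _ _ _ (H I)).
move=> z [C hC]; exists (expR C); split; first exact: expR_gt0.
move=> n; rewrite -expRD.
have -> : \prod_(i < n) kappa (z (- i%:Z)) = expR (\sum_(i < n) ln (kappa (z (- i%:Z)))).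
  by rewrite expR_sum; apply: eq_bigr => i _; rewrite lnK ?posrE.
rewrite ler_expR; have := hC n.
rewrite big_split/= sumr_const card_ord -[_ *+ n]mulr_natl.
have : \sum_(i < n) ln (kappa (z (- i%:Z))) <=
    \sum_(i < n) Num.max (ln (kappa (z (- i%:Z)))) (- M%:R).
  by apply: ler_sum => i _; rewrite le_max lexx.
by move=> ?; lra.
Qed.

End Decay.

(** * Independence of the past and the fresh noise *)

Section Noise.
Context (R : realType) dO (Omega : measurableType dO) (P : probability Omega R).
Context d1 (T1 : measurableType d1) d2 (T2 : measurableType d2).
Variable Z : int -> {mfun Omega >-> T1}.
Variable eps : int -> {mfun Omega >-> T2}.
Hypothesis Heps_indep : mutually_independent P (fun t w => eps t w).
Hypothesis Heps_id : identically_distributed P (fun t w => eps t w).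
Hypothesis HepsZ : independent_sigma P (sigma_gen (fun t w => eps t w) setT)
                               (sigma_gen (fun t w => Z t w) setT).

Lemma fincyl_law (s : seq int) (A : int -> set T2) : uniq s ->
  (forall t, measurable (A t)) ->
  path_law P eps (fincyl s A) = (\prod_(t <- s) fine (P (eps 0 @^-1` A t)))%:E.
Proof.
move=> us mA; have := Heps_indep us mA.
under [in X in _ = X -> _]eq_bigr do rewrite (Heps_id _ (mA _)).
by move=> <-; congr (P _); apply/seteqP; split.
Qed.

Lemma path_law_independent (B : set (pathType T1)) (C : set (pathType T2)) :
  measurable B -> measurable C ->
  P (pathRV Z @^-1` B `&` pathRV eps @^-1` C) =
  (path_law P Z B * path_law P eps C)%E.
Proof.
move=> mB mC; rewrite setIC muleC; apply: HepsZ; exact: sigma_gen_pathRV.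
Qed.

(* The past up to time t, together with the whole environment Z. *)
Definition past_gen (t : int) : set (set Omega) :=
  [set H | exists B C, [/\ path_measurable B, fincyls [set j | j <= t] C &
     H = pathRV Z @^-1` B `&` pathRV eps @^-1` C]].

Notation past t := (g_sigma_algebraType (past_gen t)).

Lemma past_gen_setI t : setI_closed (past_gen t).
Proof.
move=> _ _ [B [C [mB mC ->]]] [B' [C' [mB' mC' ->]]].
exists (B `&` B'), (C `&` C'); split.
- exact: (@measurableI _ (pathType T1)).
- exact: fincyls_setI.
- by rewrite !preimage_setI setIACA.
Qed.

Lemma fincyls_measurable J (C : set (pathType T2)) : fincyls J C -> measurable C.
Proof. by move=> [s [A [_ _ mA ->]]]; exact: measurable_fincyl. Qed.

Lemma past_measurable t (H : set Omega) :
  measurable (H : set (past t)) -> measurable H.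
Proof.
apply: smallest_sub; first exact: sigma_algebra_measurable.
move=> _ [B [C [mB /fincyls_measurable mC ->]]].
by apply: measurableI; rewrite -[X in measurable X]setTI; apply: measurable_funPT.
Qed.

Lemma past_le s t (H : set Omega) : s <= t ->
  measurable (H : set (past s)) -> measurable (H : set (past t)).
Proof.
move=> st; apply: sub_sigma_algebra2 => _ [B [C [mB [r [A [ur rs mA ->]]] ->]]].
exists B, (fincyl r A); split => //; exists r, A; split => // j /rs /=.
by move=> js; exact: le_trans st.
Qed.

Lemma measurable_past_Z t j : measurable_fun setT (Z j : past t -> T1).
Proof.
move=> _ A mA; rewrite setTI; apply: sub_sigma_algebra.
exists [set z | A (z j)], setT; split.
- by apply: sub_sigma_algebra; exists j, A.
- exact: fincyls_setT.
- by rewrite preimage_setT setIT.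
Qed.

Lemma measurable_past_pathZ t : measurable_fun setT (pathRV Z : past t -> pathType T1).
Proof. by apply: measurable_fun_path => j; exact: measurable_past_Z. Qed.

Lemma measurable_past_eps t j : j <= t -> measurable_fun setT (eps j : past t -> T2).
Proof.
move=> jt _ A mA; rewrite setTI; apply: sub_sigma_algebra.
exists setT, (fincyl [:: j] (fun=> A)); split.
- exact: (@measurableT _ (pathType T1)).
- by exists [:: j], (fun=> A); split => // k; rewrite inE => /eqP ->.
- rewrite preimage_setT setTI; apply/seteqP; split => w /=.
    by move=> Aw k; rewrite inE => /eqP ->.
  by apply; rewrite inE.
Qed.

Lemma measurable_past_le s t dS (S : measurableType dS) (f : Omega -> S) : s <= t ->
  measurable_fun setT (f : past s -> S) -> measurable_fun setT (f : past t -> S).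
Proof. by move=> st mf _ A mA; apply: (past_le st); apply: mf. Qed.

Lemma measurable_past_fun t dS (S : measurableType dS) (f : Omega -> S) :
  measurable_fun setT (f : past t -> S) -> measurable_fun setT f.
Proof. by move=> mf _ A mA; apply: (@past_measurable t); apply: mf. Qed.

(** On a generator the index [t + 1] is absent from the list of noise indices, all at most [t];
    adjoining it gives one more finite cylinder, to which the product formula and the independence
    from [Z] apply. Dynkin's lemma extends this to the past. *)
Lemma past_independent t (H : set Omega) (V : set T2) :
  measurable (H : set (past t)) -> measurable V ->
  P (H `&` eps (t + 1) @^-1` V) = (P H * P (eps (t + 1) @^-1` V))%E.
Proof.
move=> mH mV.
have mV' : measurable (eps (t + 1) @^-1` V).
  by rewrite -[X in measurable X]setTI; exact: measurable_funPT.
apply: (@dynkin_induction _ (past t) (past_gen t)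
  (fun H => P (H `&` eps (t + 1) @^-1` V) = (P H * P (eps (t + 1) @^-1` V))%E)) => //.
- exact: past_gen_setI.
- by rewrite setTI probability_setT mul1e.
- move=> _ [B [C [mB [s [A [us st mA ->]]] ->]]].
  have nts : t + 1 \notin s by apply/negP => /st /=; lia.
  rewrite -setIA.
  have -> : pathRV eps @^-1` fincyl s A `&` eps (t + 1) @^-1` V =
     pathRV eps @^-1` fincyl (t + 1 :: s) (fun j => if j == t + 1 then V else A j).
    apply/seteqP; split => w /=.
      move=> [ws wV] j; rewrite inE; case: eqP => [->//|_ /= js]; exact: ws.
    move=> h; split; last by have := h (t + 1); rewrite inE eqxx; apply.
    move=> j js; have := h j; rewrite inE js orbT; case: eqP => [jt|_]; last by apply.
    by move: nts; rewrite -jt js.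
  rewrite path_law_independent//; [|exact: measurable_fincyl].
  rewrite path_law_independent//; [|by apply: measurable_fincyl => j; case: ifP].
  rewrite !fincyl_law//=; [|by rewrite nts|by move=> j /=; case: ifP].
  rewrite big_cons eqxx (Heps_id (t + 1) mV) EFinM.
  rewrite fineK ?fin_num_measure//; last first.
    by rewrite -[X in measurable X]setTI; exact: measurable_funPT.
  have -> : \prod_(j <- s) fine (P (eps 0 @^-1` (if j == t + 1 then V else A j))) =
      \prod_(j <- s) fine (P (eps 0 @^-1` A j)).
    rewrite big_seq [RHS]big_seq; apply: eq_bigr => j js.
    by case: eqP => // jt; move: nts; rewrite -jt js.
  by rewrite muleCA muleC.
- move=> S /past_measurable mS hS.
  rewrite setIC -setDE measureD//; last by rewrite ltey_eq fin_num_measure.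
  rewrite [X in (_ - X)%E](_ : _ = (P S * P (eps (t + 1) @^-1` V))%E); last first.
    by rewrite setIC; exact: hS.
  rewrite [P (~` S)]probability_setC// muleBl// ?mul1e//.
  by rewrite fin_num_measure.
- move=> F mF tF hF; have mF' n := past_measurable (mF n).
  rewrite setI_bigcupl measure_bigcup//=; last 2 first.
  - by move=> n _; exact: measurableI.
  - by apply: trivIset_setIr.
  have [v vE] : exists v, P (eps (t + 1) @^-1` V) = v%:E.
    by exists (fine (P (eps (t + 1) @^-1` V))); rewrite fineK// fin_num_measure.
  rewrite [in RHS]measure_bigcup//= vE muleC -nneseriesZl//.
  by apply: eq_eseriesr => n _; rewrite muleC -vE; exact: hF.
Qed.

End Noise.

(** * Contraction in mean *)

Section FreshNoise.
Context (R : realType) dO (Omega : measurableType dO) (P : probability Omega R).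
Context d1 (T1 : measurableType d1) d2 (T2 : measurableType d2).
Variable Z : int -> {mfun Omega >-> T1}.
Variable eps : int -> {mfun Omega >-> T2}.
Hypothesis Heps_indep : mutually_independent P (fun t w => eps t w).
Hypothesis Heps_id : identically_distributed P (fun t w => eps t w).
Hypothesis HepsZ : independent_sigma P (sigma_gen (fun t w => eps t w) setT)
                               (sigma_gen (fun t w => Z t w) setT).

Notation past t := (g_sigma_algebraType (past_gen Z eps t)).

(** The identity of [Omega], retyped: as a random variable with values in the past it allows the
    joint law of past and next noise to be a product measure. *)
Definition to_past t (w : Omega) : past t := w.

Lemma measurable_to_past t : measurable_fun setT (to_past t).
Proof. by move=> _ A mA; rewrite setTI; exact: (@past_measurable _ _ _ _ _ _ Z eps t _ mA). Qed.

HB.instance Definition _ t :=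
  isMeasurableFun.Build _ _ _ _ (to_past t) (@measurable_to_past t).

Definition past_noise t (w : Omega) : past t * T2 := (to_past t w, eps (t + 1) w).

Lemma measurable_past_noise t : measurable_fun setT (past_noise t).
Proof.
exact: (measurable_fun_pair (@measurable_to_past t) (measurable_funPT (eps (t + 1)))).
Qed.

HB.instance Definition _ t :=
  isMeasurableFun.Build _ _ _ _ (past_noise t) (@measurable_past_noise t).

Lemma integral_noise_law t (f : T2 -> \bar R) :
  (\int[distribution P (eps t)]_u f u = \int[distribution P (eps 0)]_u f u)%E.
Proof. by apply: eq_measure_integral => A mA _; exact: Heps_id. Qed.

(** The freezing lemma: the law of [past_noise t] is a product, and Fubini-Tonelli integrates the
    next noise while everything known at [t], including all of [Z], is held fixed. *)
Lemma integral_fresh_noise t (h : past t * T2 -> \bar R) :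
  measurable_fun setT h -> (forall x, 0 <= h x)%E ->
  (\int[P]_w h (w, eps (t + 1) w) =
   \int[P]_w \int[distribution P (eps 0)]_u h (w, u))%E.
Proof.
move=> mh h0.
transitivity (\int[distribution P (past_noise t)]_x h x)%E.
  by rewrite ge0_integral_distribution.
transitivity (\int[distribution P (to_past t) \x distribution P (eps (t + 1))]_x h x)%E.
  apply: eq_measure_integral => A mA _; apply/esym.
  by apply: (product_measure_unique _ mA) => B C mB mC; exact: (past_independent Heps_indep Heps_id HepsZ mB mC).
rewrite fubini_tonelli1// ge0_integral_distribution//; last 2 first.
- exact: measurable_fun_fubini_tonelli_F.
- by move=> y; exact: integral_ge0.
by apply: eq_integral => w _; exact: (integral_noise_law (t + 1)%R).
Qed.

End FreshNoise.

Section Contraction.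
Context (R : realType) dO (Omega : measurableType dO) (P : probability Omega R).
Context dE (E : measurableType dE) (dist : E -> E -> R).
Context d1 (T1 : measurableType d1) d2 (T2 : measurableType d2).
Hypothesis HE : polish_borel dist.
Variable Z : int -> {mfun Omega >-> T1}.
Variable eps : int -> {mfun Omega >-> T2}.
Hypothesis Heps_indep : mutually_independent P (fun t w => eps t w).
Hypothesis Heps_id : identically_distributed P (fun t w => eps t w).
Hypothesis HepsZ : independent_sigma P (sigma_gen (fun t w => eps t w) setT)
                               (sigma_gen (fun t w => Z t w) setT).
Variable F : E * T1 * T2 -> E.
Hypothesis mF : measurable_fun setT F.
Variable p : R.

Notation past t := (g_sigma_algebraType (past_gen Z eps t)).
Notation fcomp := (fcomp F (fun t w => Z t w) (fun t w => eps t w)).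
Notation nu0 := (distribution P (eps 0)).

Lemma measurable_fun_F dS (S : measurableType dS) (u : S -> E) (z : S -> T1)
    (v : S -> T2) : measurable_fun setT u -> measurable_fun setT z ->
  measurable_fun setT v -> measurable_fun setT (fun x => F (u x, z x, v x)).
Proof.
move=> mu mz mv; apply: (measurableT_comp mF (g := fun x => (u x, z x, v x))).
by apply: measurable_fun_pair => //; exact: measurable_fun_pair.
Qed.

Lemma measurable_fun_distp dS (S : measurableType dS) (u v : S -> E) :
  measurable_fun setT u -> measurable_fun setT v ->
  measurable_fun setT (fun x => dist (u x) (v x) `^ p).
Proof.
move=> mu mv; apply: (measurableT_comp (measurable_powR p)).
exact: (measurable_fun_dist HE).
Qed.

Lemma measurable_past_fcomp t n (U : Omega -> E) :
  measurable_fun setT (U : past t -> E) ->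
  measurable_fun setT ((fun w => fcomp (t + 1) n (U w) w) : past (t + n%:Z) -> E).
Proof.
move=> mU; elim: n => [|n IH] /=; first by rewrite addr0.
apply: measurable_fun_F; [|exact: measurable_past_Z|apply: measurable_past_eps; lia].
by apply: measurable_past_le IH; lia.
Qed.

(** The recursion of [fcomp] adds maps on the outside; moving the starting time back adds them on
    the inside. *)
Lemma fcompSr s n x w :
  fcomp s n.+1 x w = fcomp (s + 1) n (frand F (fun t w => Z t w) (fun t w => eps t w) s x w) w.
Proof.
elim: n => [|n IH]; first by rewrite /= addr0.
rewrite [LHS]/= -/(fcomp s n.+1 x w) IH /=.
by rewrite (_ : s + n.+1%:Z = s + 1 + n%:Z)//; lia.
Qed.

Variable kappa : T1 -> R.
Hypothesis mkappa : measurable_fun setT kappa.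
Hypothesis kappa0 : forall z, 0 < kappa z.
Hypothesis Hcontr : forall x y z,
  (\int[nu0]_u (dist (F (x, z, u)) (F (y, z, u)) `^ p)%:E
     <= (kappa z `^ p * dist x y `^ p)%:E)%E.

Lemma contraction1 t (psi : Omega -> R) (U V : Omega -> E) :
  measurable_fun setT (psi : past t -> R) -> (forall w, 0 <= psi w) ->
  measurable_fun setT (U : past t -> E) -> measurable_fun setT (V : past t -> E) ->
  (\int[P]_w (psi w * dist (F (U w, Z t w, eps (t + 1)%R w))
                           (F (V w, Z t w, eps (t + 1)%R w)) `^ p)%:E <=
   \int[P]_w (psi w * kappa (Z t w) `^ p * dist (U w) (V w) `^ p)%:E)%E.
Proof.
move=> mpsi psi0 mU mV.
pose h (x : past t * T2) := (psi x.1 * dist (F (U x.1, Z t x.1, x.2))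
                           (F (V x.1, Z t x.1, x.2)) `^ p)%:E.
have mFU (W : Omega -> E) : measurable_fun setT (W : past t -> E) ->
    measurable_fun setT (fun x : past t * T2 => F (W x.1, Z t x.1, x.2)).
  move=> mW; apply: measurable_fun_F; last exact: measurable_snd.
    exact: (measurableT_comp mW measurable_fst).
  exact: (measurableT_comp (@measurable_past_Z _ _ _ _ _ _ Z eps t t) measurable_fst).
have mh : measurable_fun setT h.
  apply/measurable_EFinP; apply: measurable_funM.
    exact: (measurableT_comp mpsi measurable_fst).
  by apply: measurable_fun_distp; exact: mFU.
have h0 x : (0 <= h x)%E by rewrite lee_fin mulr_ge0// powR_ge0.
rewrite (integral_fresh_noise Heps_indep Heps_id HepsZ mh h0).
apply: ge0_le_integral => //.
- by move=> w _; apply: integral_ge0 => u _; exact: h0.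
- apply: (@measurable_past_fun _ _ _ _ _ _ Z eps t).
  exact: (@measurable_fun_fubini_tonelli_F _ _ _ _ _ nu0 h mh h0).
- apply: (@measurable_past_fun _ _ _ _ _ _ Z eps t).
  apply/measurable_EFinP; apply: measurable_funM; last exact: measurable_fun_distp.
  apply: measurable_funM => //; apply: (measurableT_comp (measurable_powR p)).
  exact: (measurableT_comp mkappa (@measurable_past_Z _ _ _ _ _ _ Z eps t t)).
move=> w _; rewrite /h /=.
under eq_integral do rewrite EFinM.
rewrite ge0_integralZl//=.
- by rewrite -mulrA EFinM lee_wpmul2l// lee_fin.
- apply/measurable_EFinP; apply: measurable_fun_distp;
    by apply: measurable_fun_F => //; exact: measurable_cst.
- by move=> u _; rewrite lee_fin powR_ge0.
- by rewrite lee_fin.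
Qed.

Lemma contraction t n (psi : Omega -> R) (U V : Omega -> E) :
  measurable_fun setT (psi : past t -> R) -> (forall w, 0 <= psi w) ->
  measurable_fun setT (U : past t -> E) -> measurable_fun setT (V : past t -> E) ->
  (\int[P]_w (psi w * dist (fcomp (t + 1)%R n (U w) w)
                           (fcomp (t + 1)%R n (V w) w) `^ p)%:E <=
   \int[P]_w (psi w * (\prod_(i < n) kappa (Z (t + i%:Z)%R w) `^ p) *
              dist (U w) (V w) `^ p)%:E)%E.
Proof.
move=> mpsi psi0 mU mV.
elim: n psi mpsi psi0 => [|n IH] psi mpsi psi0.
  by under [X in (_ <= X)%E]eq_integral do rewrite big_ord0 mulr1.
have mk : measurable_fun setT ((fun w => kappa (Z (t + n%:Z) w) `^ p) : past t -> R).
  apply: (measurableT_comp (measurable_powR p)).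
  exact: (measurableT_comp mkappa (@measurable_past_Z _ _ _ _ _ _ Z eps t _)).
have := @contraction1 (t + n%:Z) psi (fun w => fcomp (t + 1) n (U w) w)
  (fun w => fcomp (t + 1) n (V w) w) _ psi0 (@measurable_past_fcomp t n U mU)
  (@measurable_past_fcomp t n V mV).
rewrite /= /frand (_ : t + 1 + n%:Z - 1 = t + n%:Z); last lia.
rewrite (_ : t + 1 + n%:Z = t + n%:Z + 1); last lia.
move=> H; apply: le_trans (H _) _; first by apply: measurable_past_le mpsi; lia.
apply: le_trans (IH _ _ _) _.
- exact: measurable_funM.
- by move=> w; rewrite mulr_ge0// powR_ge0.
- by under [X in (_ <= X)%E]eq_integral do rewrite big_ord_recr/= [X in _ * X * _]mulrC mulrA.
Qed.

End Contraction.

(** * Geometric bounds *)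

Lemma powR_add_le (R : realType) (a b p : R) : 0 <= a -> 0 <= b -> 0 <= p ->
  (a + b) `^ p <= 2 `^ p * (a `^ p + b `^ p).
Proof.
move=> a0 b0 p0.
have [m [m0 mab mp]] : exists m, [/\ 0 <= m, a + b <= 2 * m & m `^ p <= a `^ p + b `^ p].
  have [ab|ba] := leP a b.
    by exists b; split => //; [lra|rewrite lerDr powR_ge0].
  by exists a; split => //; [lra|rewrite lerDl powR_ge0].
apply: (@le_trans _ _ ((2 * m) `^ p)).
  by rewrite ge0_ler_powR// nnegrE; lra.
by rewrite powRM// ler_wpM2l// powR_ge0.
Qed.

Lemma geometric_nneseries_lty (R : realType) (L q : R) : 0 <= L -> 0 <= q -> q < 1 ->
  (\sum_(0 <= n <oo) (L * q ^+ n)%:E < +oo)%E.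
Proof.
move=> L0 q0 q1.
have -> : (\sum_(0 <= n <oo) (L * q ^+ n)%:E)%E = (L * (1 - q)^-1)%:E.
  apply/cvg_lim => //.
  have -> : (fun n => (\sum_(0 <= k < n) (L * q ^+ k)%:E)%E) =
     EFin \o series (geometric L q).
    by apply/funext => n; rewrite /= /series/= sumEFin.
  apply: cvg_EFin; first exact: nearW.
  have -> : fine \o (EFin \o series (geometric L q)) = series (geometric L q).
    exact/funext.
  by apply: cvg_geometric_series; rewrite ger0_norm.
exact: ltry.
Qed.

(** * Geometric bounds under the integral, exhaustion, and Dynkin's argument for limits *)

Section Measure.
Context (R : realType) d (T : measurableType d) (P : probability T R).

Lemma integral_setE_indic (A : set T) (f : T -> R) :
  (\int[P]_(x in A) (f x)%:E = \int[P]_x (\1_A x * f x)%:E)%E.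
Proof.
rewrite integral_mkcond; apply: eq_integral => x _.
by rewrite patchE indicE; case: ifP => _; rewrite ?mul1r ?mul0r.
Qed.

(* The dominating function is the sum over n of h n / q ^ n. *)
Lemma geometric_domination (A : set T) (h : nat -> T -> \bar R) (L q : R) :
  measurable A -> 0 < q -> q < 1 -> 0 <= L ->
  (forall n, measurable_fun setT (h n)) -> (forall n x, 0 <= h n x)%E ->
  (forall n, \int[P]_(x in A) h n x <= (L * (q ^+ 2) ^+ n)%:E)%E ->
  exists K : T -> \bar R, [/\ measurable_fun setT K, (forall x, 0 <= K x)%E,
    (\int[P]_(x in A) K x < +oo)%E &
    forall n x, (h n x <= K x * (q ^+ n)%:E)%E].
Proof.
move=> mA q0 q1 L0 mh h0 hL.
pose k n x := ((q ^- n)%:E * h n x)%E.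
have mk n : measurable_fun setT (k n).
  exact: (@emeasurable_funM _ _ _ setT (fun=> (q ^- n)%:E) (h n)).
have k0 n x : (0 <= k n x)%E by rewrite mule_ge0// lee_fin invr_ge0 exprn_ge0// ltW.
exists (fun x => \sum_(0 <= n <oo) k n x)%E; split.
- exact: ge0_emeasurable_sum.
- by move=> x; exact: nneseries_ge0.
- rewrite integral_nneseries//; last by move=> n; exact: measurable_funTS.
  apply: le_lt_trans (geometric_nneseries_lty L0 (ltW q0) q1).
  apply: lee_nneseries => n _; first by move=> _; exact: integral_ge0.
  rewrite /k ge0_integralZl//; last 2 first.
  - exact: measurable_funTS.
  - by rewrite lee_fin invr_ge0 exprn_ge0// ltW.
  have qn : 0 < q ^+ n by rewrite exprn_gt0.
  rewrite -(@lee_pmul2l _ (q ^+ n)%:E) ?lte_fin//.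
  rewrite muleA -!EFinM divff ?gt_eqF// mul1e; apply: le_trans (hL n) _.
  by rewrite lee_fin -exprM mulrCA -exprD addnn mul2n.
- move=> n x.
  apply: (@le_trans _ _ (k n x * (q ^+ n)%:E)%E).
    rewrite /k muleAC -EFinM mulVf ?mul1e// gt_eqF// exprn_gt0//.
  apply: lee_wpmul2r; first by rewrite lee_fin exprn_ge0// ltW.
  have := @nneseries_lim_ge _ (fun n => k n x) xpredT 0%N n.+1 (fun i _ _ => k0 i x).
  apply: le_trans; rewrite big_nat_recr//= leeDr// sume_ge0//.
Qed.

(** Half of the geometric rate pays for a dominating [K] that is integrable on [A], hence finite
    almost everywhere there; the other half, [q ^+ n], still tends to 0. *)
Lemma geometric_ae_cvg0 (A : set T) (h : nat -> T -> \bar R) (L q : R) :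
  measurable A -> 0 < q -> q < 1 -> 0 <= L ->
  (forall n, measurable_fun setT (h n)) -> (forall n x, 0 <= h n x)%E ->
  (forall n, \int[P]_(x in A) h n x <= (L * (q ^+ 2) ^+ n)%:E)%E ->
  {ae P, forall x, A x -> h ^~ x @ \oo --> 0%E}.
Proof.
move=> mA q0 q1 L0 mh h0 hL.
have [K [mK K0 Koo hK]] := geometric_domination mA q0 q1 L0 mh h0 hL.
have iK : P.-integrable A K.
  apply/integrableP; split; first exact: measurable_funTS.
  by under eq_integral do rewrite gee0_abs//.
apply: filterS (integrable_ae mA iK) => x H Ax.
have Kfin := H Ax.
apply: (@squeeze_cvge _ _ _ _ (fun=> 0%E) _ (fun n => (fine (K x) * q ^+ n)%:E)).
- by apply: nearW => n; rewrite h0 EFinM fineK//; exact: hK.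
- exact: cvg_cst.
- apply: cvg_EFin; first exact: nearW.
  by apply: cvg_geometric; rewrite ger0_norm// ltW.
Qed.

Lemma ae_exhaustion (B : nat -> set T) : (forall k, measurable (B k)) ->
  {homo B : m n / (m <= n)%N >-> m `<=` n} ->
  {ae P, forall x, exists k, B k x} ->
  forall e, 0 < e -> exists k, (P (~` B k) <= e%:E)%E.
Proof.
move=> mB ndB aeB e e0.
have mC : measurable (\bigcap_k ~` B k).
  by apply: bigcapT_measurable => k; exact: measurableC.
have C0 : P (\bigcap_k ~` B k) = 0%E.
  apply/(@negligibleP _ _ _ P) => //; apply: negligibleS aeB => x h [k Bk].
  exact: (h k).
have H : P (~` B k) @[k --> \oo] --> 0%E.
  rewrite -[X in _ --> X]C0; apply: nonincreasing_cvg_mu => //.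
  - by rewrite (le_lt_trans (probability_le1 _ _)) ?ltry//; exact: measurableC.
  - by move=> k; exact: measurableC.
  - by move=> m n mn; apply/subsetPset; apply: subsetC; exact: ndB.
apply: contrapT => /forallNP nk.
have : (e%:E <= 0)%E.
  rewrite -(cvg_lim (@ereal_hausdorff R) H); apply: lime_ge.
    by apply/cvg_ex; exists 0%E.
  by apply: nearW => k; apply/ltW; rewrite ltNge; apply/negP/nk.
by rewrite lee_fin leNgt e0.
Qed.

(** Dynkin's argument for a limit in place of an identity. The limit in [n] and an increasing union
    do not commute by themselves; the common bound by [P] makes the error from replacing the union
    by [F k] small uniformly in [n]. *)
Lemma lambda_vanishing (G : set (set T)) (m1 m2 : nat -> set T -> R) :
  measurable = <<s G >> -> setI_closed G -> G setT ->
  (forall n A B, measurable A -> measurable B -> B `<=` A ->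
     m1 n (A `\` B) = m1 n A - m1 n B) ->
  (forall n A B, measurable A -> measurable B -> B `<=` A ->
     m2 n (A `\` B) = m2 n A - m2 n B) ->
  (forall n A, measurable A -> 0 <= m1 n A <= fine (P A)) ->
  (forall n A, measurable A -> 0 <= m2 n A <= fine (P A)) ->
  (forall A, G A -> (m1 n A - m2 n A) @[n --> \oo] --> (0 : R)) ->
  forall A, measurable A -> (m1 n A - m2 n A) @[n --> \oo] --> (0 : R).
Proof.
move=> mG GI GT D1 D2 b1 b2 HG.
pose H : set (set T) :=
  [set A | measurable A /\ (m1 n A - m2 n A) @[n --> \oo] --> (0 : R)].
suff GH : <<s G >> `<=` H by move=> A; rewrite mG => /GH[].
apply: lambda_system_subset => //; last first.
  by move=> A GA; split; [rewrite mG; exact: sub_sigma_algebra|exact: HG].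
split => //.
- by split => //; exact: HG.
- move=> A B BA [mA hA] [mB hB]; split; first exact: measurableD.
  have -> : (fun n => m1 n (A `\` B) - m2 n (A `\` B)) =
      (fun n => (m1 n A - m2 n A) - (m1 n B - m2 n B)).
    by apply/funext => n; rewrite D1// D2//; ring.
  by rewrite -[X in _ --> X](subr0 0); exact: cvgB.
- move=> F ndF HF.
  have mF i : measurable (F i) by case: (HF i).
  have mU : measurable (\bigcup_i F i) by exact: bigcupT_measurable.
  split => //; apply/cvgrPdist_lt => e e0.
  have [k hk] : exists k, fine (P (\bigcup_i F i `\` F k)) < e / 2.
    have PU : P (\bigcup_i F i) \is a fin_num by rewrite fin_num_measure.
    have : P (F k) @[k --> \oo] --> (fine (P (\bigcup_i F i)))%:E.
      by rewrite fineK//; exact: nondecreasing_cvg_mu.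
    move=> /fine_cvgP[_ /cvgrPdist_lt/(_ (e / 2))[|k _ Hk]]; first lra.
    exists k; have /= := Hk k (leqnn k).
    have sub : F k `<=` \bigcup_i F i by exact: bigcup_sup.
    rewrite measureD//; last by rewrite ltey_eq fin_num_measure.
    rewrite setIidr// fineB//; last by rewrite fin_num_measure.
    rewrite ger0_norm// subr_ge0 fine_le// ?fin_num_measure//.
    by apply: le_measure; rewrite ?inE.
  have [mFk /cvgrPdist_lt/(_ (e / 2))] := HF k; move=> /(_ ltac:(lra)).
  apply: filterS => n; rewrite !sub0r !normrN => hn.
  have sub : F k `<=` \bigcup_i F i by exact: bigcup_sup.
  have mD : measurable (\bigcup_i F i `\` F k) by exact: measurableD.
  have := D1 n _ _ mU mFk sub; have := D2 n _ _ mU mFk sub.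
  have /andP[a1 a2] := b1 n _ mD; have /andP[a3 a4] := b2 n _ mD.
  move: hn hk a1 a2 a3 a4; rewrite !ltr_norml.
  move: (m1 n _) (m1 n _) (m1 n _) (m2 n _) (m2 n _) (m2 n _) (fine _) => b3 b4 b5 b6 b7 b8 b9.
  by lra.
Qed.

End Measure.

(** * Metric limits of sequences with geometrically small increments *)

Section GeometricLimit.
Context (R : realType) (dE : measure_display) (E : measurableType dE).
Variable dist : E -> E -> R.
Hypothesis HE : polish_borel dist.

(** The power [p] of a distance need not satisfy the triangle inequality, so increments are first
    bounded by [a * th ^+ n], where [a] and [th] are p-th roots of [K] and [r]. The constant [Q]
    depends on [p] and [r] alone, since [K] will vary with the sample point. *)
Lemma geometric_limit (x0 : E) (p r : R) : 1 <= p -> 0 < r -> r < 1 ->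
  exists Q, 0 <= Q /\ forall (u : nat -> E) (K : R), 0 <= K ->
    (forall n, dist (u n) (u n.+1) `^ p <= K * r ^+ n) ->
    forall n, dist (u n) (mlim dist x0 u) `^ p <= K * Q * r ^+ n.
Proof.
move=> p1 r0 r1; have p0 : 0 < p by lra.
have [th [th0 th1 thp]] : exists th, [/\ 0 < th, th < 1 & th `^ p = r].
  exists (r `^ p^-1); split; first by rewrite powR_gt0.
    have -> : 1 = 1 `^ p^-1 :> R by rewrite powR1.
    by rewrite gt0_ltr_powR// ?invr_gt0// nnegrE ?ltW.
  by rewrite -powRrM mulVf ?powRr1 ?gt_eqF// ltW.
exists ((1 - th)^-1 `^ p); split; first exact: powR_ge0.
move=> u K K0 uK.
have th1' : 0 < 1 - th by rewrite subr_gt0.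
have [a [a0 ap]] : exists a, 0 <= a /\ a `^ p = K.
  exists (K `^ p^-1); split; first exact: powR_ge0.
  by rewrite -powRrM mulVf ?powRr1 ?gt_eqF.
have thn n : (th ^+ n) `^ p = r ^+ n.
  by rewrite -(powR_mulrn n (ltW th0)) powRAC thp (powR_mulrn _ (ltW r0)).
have ud n : dist (u n) (u n.+1) <= a * th ^+ n.
  rewrite leNgt; apply/negP => lt.
  have : (a * th ^+ n) `^ p < dist (u n) (u n.+1) `^ p.
    rewrite gt0_ltr_powR// nnegrE; last exact: (dist_ge0 HE).
    by rewrite mulr_ge0// exprn_ge0// ltW.
  by rewrite powRM// ?exprn_ge0 1?ltW// ap thn; apply/negP; rewrite -leNgt.
(* Dividing [a] by [1 - th] turns partial geometric sums into telescoping differences. *)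
have [b [b0 bE bp]] : exists b, [/\ 0 <= b, a = b * (1 - th) & b `^ p = K * (1 - th)^-1 `^ p].
  exists (a / (1 - th)); split; first by rewrite divr_ge0// ltW.
    by rewrite divfK// gt_eqF.
  by rewrite powRM// ?ap// invr_ge0 ltW.
have udk n k : dist (u n) (u (n + k)%N) <= b * (th ^+ n - th ^+ (n + k)).
  elim: k => [|k IH]; first by rewrite addn0 (distxx HE) subrr mulr0.
  rewrite addnS; apply: le_trans (dist_triangle HE (u (n + k)%N) _ _) _.
  apply: le_trans (lerD IH (ud _)) _.
  have -> : a * th ^+ (n + k) = b * (th ^+ (n + k) - th ^+ (n + k).+1).
    by rewrite bE exprS -mulrA mulrBl mul1r.
  by rewrite -mulrDr addrA subrK.
have udm n m : (n <= m)%N -> dist (u n) (u m) <= b * th ^+ n.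
  move=> /subnKC <-; apply: le_trans (udk _ _) _; rewrite ler_wpM2l//.
  by rewrite lerBlDr lerDl exprn_ge0// ltW.
have cu : mcauchy dist u.
  move=> k.
  have : geometric b th n @[n --> \oo] --> (0 : R).
    by apply: cvg_geometric; rewrite ger0_norm// ltW.
  move/cvgrPdist_lt => /(_ (k.+1%:R^-1 / 2)) [|N _ HN]; first by rewrite divr_gt0// invr_gt0.
  exists N => m n Nm Nn.
  have {HN} := HN N (leqnn N); rewrite /= sub0r normrN ger0_norm; last first.
    by rewrite mulr_ge0// exprn_ge0// ltW.
  have := dist_triangle HE (u N) (u m) (u n); rewrite (distC HE (u m) (u N)).
  have := udm _ _ Nm; have := udm _ _ Nn.
  move: (k.+1%:R^-1) (dist (u m) (u n)) (dist (u N) (u m)) (dist (u N) (u n)).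
  move: (b * th ^+ N) => e1 e2 e3 e4 e5; clear -e1 e2 e3 e4 e5.
  by lra.
move=> n; have ul : dist (u n) (mlim dist x0 u) <= b * th ^+ n.
  apply/ler_addgt0Pl => e e0; have [N HN] := mcvg_mlim HE x0 cu e0.
  apply: le_trans (dist_triangle HE (u (maxn n N)) _ _) _; rewrite addrC lerD//.
    by apply/ltW/HN; rewrite leq_maxr.
  by apply: udm; rewrite leq_maxl.
have -> : K * (1 - th)^-1 `^ p * r ^+ n = (b * th ^+ n) `^ p.
  by rewrite powRM// ?exprn_ge0 1?ltW// thn bp.
rewrite ge0_ler_powR// ?nnegrE ?(dist_ge0 HE)//; first by rewrite ltW.
by rewrite mulr_ge0// exprn_ge0// ltW.
Qed.

End GeometricLimit.

(** * The pullback limit *)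

Lemma powR_prod (R : realType) n (f : 'I_n -> R) p : (forall i, 0 <= f i) ->
  \prod_(i < n) f i `^ p = (\prod_(i < n) f i) `^ p.
Proof.
elim: n f => [|n IH] f f0; first by rewrite !big_ord0 powR1.
by rewrite !big_ord_recr/= IH// powRM// prodr_ge0.
Qed.

Lemma subz_succ (t : int) (n : nat) : t - n.+1%:Z + 1 = t - n%:Z.
Proof. lia. Qed.

Section Main.
Context (R : realType) dO (Omega : measurableType dO) (P : probability Omega R).
Context dE (E : measurableType dE) (dist : E -> E -> R).
Context d1 (T1 : measurableType d1) d2 (T2 : measurableType d2).
Hypothesis HE : polish_borel dist.
Variable Z : int -> {mfun Omega >-> T1}.
Variable eps : int -> {mfun Omega >-> T2}.
Hypothesis HZstat : stationary P (fun t w => Z t w).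
Hypothesis HZerg : ergodic P (fun t w => Z t w).
Hypothesis Heps_indep : mutually_independent P (fun t w => eps t w).
Hypothesis Heps_id : identically_distributed P (fun t w => eps t w).
Hypothesis HepsZ : independent_sigma P (sigma_gen (fun t w => eps t w) setT)
                               (sigma_gen (fun t w => Z t w) setT).
Variable F : E * T1 * T2 -> E.
Hypothesis mF : measurable_fun setT F.
Variable p : R.
Hypothesis hp : 1 <= p.

Notation past t := (g_sigma_algebraType (past_gen Z eps t)).
Notation fcomp := (fcomp F (fun t w => Z t w) (fun t w => eps t w)).
Notation nu0 := (distribution P (eps 0)).

Variable kappa : T1 -> R.
Hypothesis mkappa : measurable_fun setT kappa.
Hypothesis kappa0 : forall z, 0 < kappa z.
Hypothesis Hcontr : forall x y z,
  (\int[nu0]_u (dist (F (x, z, u)) (F (y, z, u)) `^ p)%:E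
     <= (kappa z `^ p * dist x y `^ p)%:E)%E.

Variable x0 : E.
Variable c : T1 -> R.
Hypothesis mc : measurable_fun setT c.
Hypothesis c_ge0 : forall z, 0 <= c z.
Hypothesis cE : forall z,
  (\int[nu0]_u (dist x0 (F (x0, z, u)) `^ p)%:E = (c z)%:E)%E.

(** The fourth power leaves room for two losses of half the rate: increments of order
    [(q ^+ 4) ^+ n] in mean give distances to the limit of order [(q ^+ 2) ^+ n] in mean, and these
    give order [q ^+ n] almost surely. The first product controls two runs from different points,
    the second one the increments. *)
Definition good_env (q C : R) : set (int -> T1) := [set z | forall n : nat,
  \prod_(i < n) kappa (z (- i%:Z)) `^ p <= C * (q ^+ 4) ^+ n /\
  \prod_(i < n) kappa (z (- i%:Z)) `^ p * c (z (- n%:Z)) <= C * (q ^+ 4) ^+ n].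

Lemma measurable_logp : measurable_fun setT (@logp R).
Proof.
apply: measurable_fun_ifT; [|exact: measurable_ln|exact: measurable_cst].
by apply: measurable_fun_ler; [exact: measurable_cst|exact: measurable_id].
Qed.

Lemma logp_ge0 (x : R) : 0 <= logp x.
Proof. by rewrite /logp; case: ifP => // x1; exact: ln_ge0. Qed.

Lemma le_expR_logp (x : R) : x <= expR (logp x).
Proof.
rewrite /logp; case: ifP => [x1|/negbT]; first by rewrite lnK// posrE (lt_le_trans ltr01).
by rewrite -ltNge expR0 => /ltW.
Qed.

Lemma good_ae : (\int[P]_w (logp (kappa (Z 0 w)))%:E < +oo)%E ->
  (\int[P]_w (ln (kappa (Z 0 w)))%:E < 0)%E ->
  (\int[P]_w (logp (c (Z 0 w)))%:E < +oo)%E ->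
  exists q, [/\ 0 < q, q < 1 &
  {ae path_law P Z, forall z, exists C : nat, good_env q C%:R z}].
Proof.
move=> kappa_logp kappa_ln c_logp.
have [delta [delta0 Hk]] := ergodic_product_decay HZstat HZerg mkappa kappa0 kappa_logp kappa_ln.
have mlc : measurable_fun setT (fun z => logp (c z)).
  exact: (measurableT_comp measurable_logp).
have ilc : P.-integrable setT (fun w => (logp (c (Z 0 w)))%:E).
  apply/integrableP; split.
    by apply/measurable_EFinP; exact: (measurableT_comp mlc).
  by under eq_integral do rewrite gee0_abs ?lee_fin ?logp_ge0//.
have Hc := ergodic_growth HZstat HZerg mlc (divr_gt0 delta0 (ltr0n R 2)) ilc.
have e4 : expR (- delta / 8) ^+ 4 = expR (- (delta / 2)).
  by rewrite -expRM_natl; congr expR; lra.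
have p0 : 0 <= p by exact: le_trans hp.
(* Products of [kappa] decay like [expR (- delta * n%:R)] and [c] grows at most like
   [expR (delta / 2 * n%:R)]; the net factor per step, [expR (- (delta / 2))], is [q ^+ 4]. *)
exists (expR (- delta / 8)); split; [exact: expR_gt0|by rewrite expR_lt1; lra|].
apply: (@filterS2 _ _ (ae_filter_ringOfSetsType _) _ _ _ _ Hk Hc).
move=> z [C1 [C10 h1]] [C2 h2]; exists (Num.bound (C1 `^ p * (1 + expR C2))).
have BC : C1 `^ p * (1 + expR C2) <= (Num.bound (C1 `^ p * (1 + expR C2)))%:R.
  by apply/ltW/archi_boundP; rewrite mulr_ge0 ?powR_ge0// addr_ge0// expR_ge0.
rewrite /good_env/= e4 => n.
set D := (Num.bound _)%:R in BC *.
have C1p := powR_ge0 C1 p.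
have eC2 := expR_ge0 C2.
have [v [v0 v1 vE vd vi]] : exists v, [/\ 0 < v, v <= 1, expR (- (delta / 2)) ^+ n = v,
    expR (- delta * n%:R) = v * v & expR (delta / 2 * n%:R) = v^-1].
  exists (expR (- (delta / 2)) ^+ n); split => //.
  - by rewrite exprn_gt0// expR_gt0.
  - by rewrite exprn_ile1 ?expR_ge0// expR_le1; lra.
  - by rewrite -expRM_natl -expRD; congr expR; lra.
  - by rewrite -expRM_natl -expRN; congr expR; lra.
rewrite vE powR_prod; last by move=> i; exact: ltW.
have Hpi : (\prod_(i < n) kappa (z (- i%:Z))) `^ p <= C1 `^ p * (v * v).
  apply: (@le_trans _ _ ((C1 * (v * v)) `^ p)).
    rewrite ge0_ler_powR ?nnegrE//.
    - by apply: prodr_ge0 => i _; exact: ltW.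
    - by rewrite !mulr_ge0// ltW.
    - by rewrite -vd h1.
  rewrite (powRM _ (ltW C10)); last by rewrite mulr_ge0// ltW.
  apply: ler_wpM2l => //.
  (* Here [1 <= p] enters: the power [p] does not increase a number of []0, 1]]. *)
  have vv : 0 < v * v by rewrite mulr_gt0.
  have vv1 : v * v <= 1 by rewrite mulr_ile1// ltW.
  by apply: ge1r_powR => //; rewrite vv.
have vv : v * v <= v by rewrite -[leRHS]mulr1 ler_wpM2l// ltW.
split.
  apply: le_trans Hpi _; apply: ler_pM => //; first by rewrite mulr_ge0// ltW.
  apply: le_trans BC; rewrite -[leLHS]mulr1; apply: ler_wpM2l => //; lra.
have cn : c (z (- n%:Z)) <= expR C2 * v^-1.
  apply: le_trans (le_expR_logp _) _; rewrite -vi -expRD ler_expR; exact: h2.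
apply: le_trans (ler_pM _ (c_ge0 _) Hpi cn) _; first exact: powR_ge0.
have -> : C1 `^ p * (v * v) * (expR C2 * v^-1) = C1 `^ p * expR C2 * v.
  by field; rewrite gt_eqF.
apply: ler_wpM2r; first exact: ltW.
by apply: le_trans BC; apply: ler_wpM2l => //; lra.
Qed.

Lemma measurable_good q C : measurable (good_env q C : set (pathType T1)).
Proof.
have mprod n : measurable_fun setT
    (fun z : pathType T1 => \prod_(i < n) kappa (z (- i%:Z)) `^ p).
  apply: measurable_prod => i _; apply: (measurableT_comp (measurable_powR p)).
  exact: (measurableT_comp mkappa (@measurable_path_eval _ T1 _)).
have mle (f : pathType T1 -> R) a : measurable_fun setT f ->
    measurable [set z | f z <= a].
  move=> mf; rewrite (_ : mkset _ = f @^-1` `]-oo, a]); last first.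
    by apply/seteqP; split => z /=; rewrite in_itv.
  by rewrite -[X in measurable X]setTI; exact: mf.
rewrite (_ : good_env q C = \bigcap_n
   ([set z : pathType T1 | \prod_(i < n) kappa (z (- i%:Z)) `^ p <= C * (q ^+ 4) ^+ n] `&`
    [set z : pathType T1 | \prod_(i < n) kappa (z (- i%:Z)) `^ p * c (z (- n%:Z))
       <= C * (q ^+ 4) ^+ n])).
  apply: bigcapT_measurable => n; apply: measurableI; apply: mle => //.
  apply: measurable_funM => //.
  exact: (measurableT_comp mc (@measurable_path_eval _ T1 _)).
by apply/seteqP; split => z H n; [move=> _; exact: H|exact: (H n I)].
Qed.

(** The origin is moved to [t - 1] because f_t reads [Z (t - 1)]. *)
Definition good_at q C t : set Omega := [set w | good_env q C (shiftn (t - 1) (pathRV Z w))].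

Lemma goodtP q C t w : good_at q C t w <-> forall n : nat,
  \prod_(i < n) kappa (Z (t - 1 - i%:Z) w) `^ p <= C * (q ^+ 4) ^+ n /\
  \prod_(i < n) kappa (Z (t - 1 - i%:Z) w) `^ p * c (Z (t - 1 - n%:Z) w)
    <= C * (q ^+ 4) ^+ n.
Proof.
have zE (i : nat) : shiftn (t - 1) (pathRV Z w) (- i%:Z) = Z (t - 1 - i%:Z) w.
  by rewrite /shiftn /pathRV addrC.
have pE (n : nat) : \prod_(i < n) kappa (shiftn (t - 1) (pathRV Z w) (- i%:Z)) `^ p =
    \prod_(i < n) kappa (Z (t - 1 - i%:Z) w) `^ p.
  by apply: eq_bigr => i _; rewrite zE.
by rewrite /good_at/= /good_env/=; split => H n; have := H n; rewrite pE zE.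
Qed.

Lemma goodt_ae q t : {ae path_law P Z, forall z, exists C : nat, good_env q C%:R z} ->
  {ae P, forall w, exists C : nat, good_at q C%:R t w}.
Proof. exact: ae_path_shiftn. Qed.

Lemma goodt_nd q t : 0 < q ->
  {homo (fun C : nat => good_at q C%:R t) : m n / (m <= n)%N >-> m `<=` n}.
Proof.
move=> q0 m n mn w /goodtP H; apply/goodtP => k; have [h1 h2] := H k.
have mn' : m%:R * (q ^+ 4) ^+ k <= n%:R * (q ^+ 4) ^+ k.
  by rewrite ler_wpM2r ?ler_nat// exprn_ge0// exprn_ge0// ltW.
by split; [exact: le_trans mn'|exact: le_trans mn'].
Qed.

Definition Zevent (A : set Omega) := exists2 B, path_measurable B & A = pathRV Z @^-1` B.

Lemma Zevent_goodt q C t : Zevent (good_at q C t).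
Proof.
exists (shiftn (t - 1) @^-1` good_env q C) => //.
have := @measurable_shiftn _ T1 (t - 1) measurableT _ (measurable_good q C).
by rewrite setTI.
Qed.

Lemma ZeventI A B : Zevent A -> Zevent B -> Zevent (A `&` B).
Proof.
move=> [A' mA ->] [B' mB ->]; exists (A' `&` B') => //.
exact: (@measurableI _ (pathType T1)).
Qed.

(** The indicator of a good event depends on the environment up to [t - 1], yet it is an admissible
    weight at the earlier time from which a run starts. *)
Lemma measurable_Zevent_past A s : Zevent A -> measurable (A : set (past s)).
Proof.
move=> [B mB ->]; have := @measurable_past_pathZ _ _ _ _ _ _ Z eps s measurableT _ mB.
by rewrite setTI.
Qed.

Lemma measurable_Zevent A : Zevent A -> measurable A.
Proof. by move=> /(@measurable_Zevent_past _ 0)/past_measurable. Qed.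

Lemma sigma_gen_Zevent A : Zevent A -> sigma_gen (fun t w => Z t w) setT A.
Proof. by move=> [B mB ->]; exact: sigma_gen_pathRV. Qed.

Lemma measurable_fun_Zprod s t n : measurable_fun setT
  ((fun w => \prod_(i < n) kappa (Z (t - 1 - i%:Z) w) `^ p) : past s -> R).
Proof.
apply: measurable_prod => i _; apply: (measurableT_comp (measurable_powR p)).
exact: (measurableT_comp mkappa (@measurable_past_Z _ _ _ _ _ _ Z eps s _)).
Qed.

Lemma measurable_fun_distp_past s (U V : Omega -> E) :
  measurable_fun setT (U : past s -> E) -> measurable_fun setT (V : past s -> E) ->
  measurable_fun setT (fun w => (dist (U w) (V w) `^ p)%:E).
Proof.
move=> mU mV; apply: (@measurable_past_fun _ _ _ _ _ _ Z eps s).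
by apply/measurable_EFinP; exact: measurable_fun_distp.
Qed.

Lemma contraction_rev t n A (U V : Omega -> E) : Zevent A ->
  measurable_fun setT (U : past (t - n%:Z) -> E) ->
  measurable_fun setT (V : past (t - n%:Z) -> E) ->
  (\int[P]_(w in A) (dist (fcomp (t - n%:Z + 1)%R n (U w) w)
                          (fcomp (t - n%:Z + 1)%R n (V w) w) `^ p)%:E <=
   \int[P]_(w in A) (\prod_(i < n) kappa (Z (t - 1 - i%:Z)%R w) `^ p *
              dist (U w) (V w) `^ p)%:E)%E.
Proof.
move=> ZA mU mV; rewrite integral_setE_indic [X in (_ <= X)%E]integral_setE_indic.
have := @contraction _ _ _ P _ _ _ _ _ _ _ HE Z eps Heps_indep Heps_id HepsZ F mF p kappa
  mkappa Hcontr (t - n%:Z) n (\1_A) U V.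
move=> /(_ _ _ mU mV) H; apply: le_trans (H _ _) _.
- by apply: measurable_indic; exact: measurable_Zevent_past.
- by move=> w; rewrite indicE.
- rewrite le_eqVlt; apply/orP; left; apply/eqP.
  apply: eq_integral => w _; rewrite mulrA; congr ((_ * _ * _)%:E).
  (* [contraction] multiplies forward from [t - n%:Z], the good event backward from [t - 1]. *)
  rewrite (reindex_inj rev_ord_inj)/=; apply: eq_bigr => i _.
  by congr (kappa (Z _ _) `^ _); have := ltn_ord i; lia.
Qed.

Lemma contraction_good q C t n A (U V : Omega -> E) : 0 < q -> 0 <= C -> Zevent A ->
  A `<=` good_at q C t ->
  measurable_fun setT (U : past (t - n%:Z) -> E) ->
  measurable_fun setT (V : past (t - n%:Z) -> E) ->
  (\int[P]_(w in A) (dist (fcomp (t - n%:Z + 1)%R n (U w) w)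
                          (fcomp (t - n%:Z + 1)%R n (V w) w) `^ p)%:E <=
   (C * (q ^+ 4) ^+ n)%:E * \int[P]_(w in A) (dist (U w) (V w) `^ p)%:E)%E.
Proof.
move=> q0 C0 ZA AC mU mV; apply: le_trans (contraction_rev ZA mU mV) _.
have mA := measurable_Zevent ZA.
have md := measurable_fun_distp_past mU mV.
rewrite -ge0_integralZl//; last 3 first.
- exact: measurable_funTS.
- by move=> w _; rewrite lee_fin powR_ge0.
- by rewrite lee_fin mulr_ge0// exprn_ge0// exprn_ge0// ltW.
apply: ge0_le_integral => //.
- move=> w _; rewrite lee_fin mulr_ge0 ?powR_ge0//.
  by apply: prodr_ge0 => i _; exact: powR_ge0.
- apply: measurable_funTS; apply: (@measurable_past_fun _ _ _ _ _ _ Z eps (t - n%:Z)).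
  apply/measurable_EFinP; apply: measurable_funM; first exact: measurable_fun_Zprod.
  exact: measurable_fun_distp.
- apply: measurable_funTS; apply/measurable_EFinP; apply: measurable_funM => //.
  exact/measurable_EFinP.
- move=> w /AC /goodtP/(_ n)[h _].
  by rewrite -EFinM lee_fin ler_wpM2r// powR_ge0.
Qed.

Lemma increment_good q C t n : 0 < q -> 0 <= C ->
  (\int[P]_(w in good_at q C t) (dist (fcomp (t - n%:Z + 1)%R n x0 w)
                          (fcomp (t - n.+1%:Z + 1)%R n.+1 x0 w) `^ p)%:E <=
   (C * (q ^+ 4) ^+ n)%:E)%E.
Proof.
move=> q0 C0; set A := good_at q C t.
have ZA : Zevent A by exact: Zevent_goodt.
have mA := measurable_Zevent ZA.
pose s := t - 1 - n%:Z.
have sE : s + 1 = t - n%:Z by rewrite /s; lia.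
(* [V] is the first step of the longer run; after it both runs apply the same [n] maps, so the
   increment contracts like two runs started from [x0] and [V]. *)
pose V w := F (x0, Z s w, eps (s + 1) w).
have mV : measurable_fun setT (V : past (t - n%:Z) -> E).
  apply: (measurable_fun_F mF); first exact: measurable_cst.
    exact: measurable_past_Z.
  by apply: measurable_past_eps; rewrite sE.
have -> : (fun w => (dist (fcomp (t - n%:Z + 1)%R n x0 w)
     (fcomp (t - n.+1%:Z + 1)%R n.+1 x0 w) `^ p)%:E) =
   (fun w => (dist (fcomp (t - n%:Z + 1)%R n x0 w)
     (fcomp (t - n%:Z + 1)%R n (V w) w) `^ p)%:E).
  apply/funext => w; rewrite fcompSr /frand /V sE.
  rewrite subz_succ.
  by rewrite (_ : t - n%:Z - 1 = s)//; rewrite /s; lia.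
apply: le_trans (contraction_rev ZA (@measurable_cst _ _ _ _ _ x0) mV) _.
rewrite integral_setE_indic.
pose psi w := \1_A w * \prod_(i < n) kappa (Z (t - 1 - i%:Z) w) `^ p.
have psi0 w : 0 <= psi w.
  by rewrite mulr_ge0 ?indicE//; apply: prodr_ge0 => i _; exact: powR_ge0.
have mpsi r : measurable_fun setT (psi : past r -> R).
  apply: measurable_funM; last exact: measurable_fun_Zprod.
  by apply: measurable_indic; exact: measurable_Zevent_past.
pose h (x : past s * T2) := (psi x.1 * dist x0 (F (x0, Z s x.1, x.2)) `^ p)%:E.
have mh : measurable_fun setT h.
  apply/measurable_EFinP; apply: measurable_funM.
    exact: (measurableT_comp (mpsi s) measurable_fst).
  apply: (measurable_fun_distp HE); first exact: measurable_cst.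
  apply: (measurable_fun_F mF); [exact: measurable_cst| |exact: measurable_snd].
  exact: (measurableT_comp (@measurable_past_Z _ _ _ _ _ _ Z eps s s) measurable_fst).
have h0 x : (0 <= h x)%E by rewrite lee_fin mulr_ge0// powR_ge0.
(* The noise left inside [V] is [eps (s + 1)], fresh for [past s], where the weight is known;
   integrating it out turns the distance from [x0] to [V] into [c (Z s w)]. *)
have := integral_fresh_noise Heps_indep Heps_id HepsZ mh h0.
under eq_integral do rewrite /h/= -/(V _) /psi -mulrA.
move=> ->.
have -> : (C * (q ^+ 4) ^+ n)%:E = (\int[P]_w (C * (q ^+ 4) ^+ n)%:E)%E.
  by rewrite prob_integral_cst.
apply: ge0_le_integral => //.
- by move=> w _; apply: integral_ge0 => u _; exact: h0.
- apply: (@measurable_past_fun _ _ _ _ _ _ Z eps s).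
  exact: (@measurable_fun_fubini_tonelli_F _ _ _ _ _ nu0 h mh h0).
move=> w _; rewrite /h /=.
under eq_integral do rewrite EFinM.
rewrite ge0_integralZl//=; last 3 first.
- apply/measurable_EFinP; apply: (measurable_fun_distp HE); first exact: measurable_cst.
  by apply: (measurable_fun_F mF) => //; exact: measurable_cst.
- by move=> u _; rewrite lee_fin powR_ge0.
- by rewrite lee_fin.
rewrite cE -EFinM lee_fin /psi indicE; case: (boolP (w \in A)) => [|_]; last first.
  by rewrite !mul0r mulr_ge0// exprn_ge0// exprn_ge0// ltW.
by rewrite inE => /goodtP/(_ n)[_]; rewrite mul1r.
Qed.

Definition pullback_limit (t : int) (w : Omega) : E :=
  mlim dist x0 (fun n => fcomp (t - n%:Z + 1) n x0 w).

Lemma measurable_fcomp s n x : measurable_fun setT (fcomp s n x).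
Proof.
elim: n => [|n IH] /=; first exact: measurable_cst.
by apply: (measurable_fun_F mF) => //; exact: measurable_funPT.
Qed.

Lemma measurable_pullback_limit t : measurable_fun setT (pullback_limit t).
Proof. by apply: (measurable_mlim HE) => n; exact: measurable_fcomp. Qed.

Lemma measurable_distp_pullback_limit t s n x :
  measurable_fun setT (fun w => (dist (fcomp s n x w) (pullback_limit t w) `^ p)%:E).
Proof.
apply/measurable_EFinP; apply: (measurable_fun_distp HE); [exact: measurable_fcomp|exact: measurable_pullback_limit].
Qed.

Lemma limit_good q C t : 0 < q -> q < 1 -> 0 <= C -> exists L, 0 <= L /\ forall n,
  (\int[P]_(w in good_at q C t) (dist (fcomp (t - n%:Z + 1)%R n x0 w) (pullback_limit t w) `^ p)%:E <=
   (L * (q ^+ 2) ^+ n)%:E)%E.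
Proof.
move=> q0 q1 C0.
have mA : measurable (good_at q C t) by apply/measurable_Zevent/Zevent_goodt.
have q20 : 0 < q ^+ 2 by rewrite exprn_gt0.
have q21 : q ^+ 2 < 1 by rewrite expr2 mulr_ilt1// ltW.
have [n|n x|n|K [mK K0 Koo HK]] := @geometric_domination _ _ _ P (good_at q C t)
  (fun n w => (dist (fcomp (t - n%:Z + 1)%R n x0 w)
                   (fcomp (t - n.+1%:Z + 1)%R n.+1 x0 w) `^ p)%:E)
  C (q ^+ 2) mA q20 q21 C0.
- apply/measurable_EFinP; apply: (measurable_fun_distp HE); exact: measurable_fcomp.
- by rewrite lee_fin powR_ge0.
- rewrite (_ : (q ^+ 2) ^+ 2 = q ^+ 4); last by rewrite -exprM.
  exact: increment_good.
have [Q [Q0 HQ]] := geometric_limit HE x0 hp q20 q21.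
have IK0 : (0 <= \int[P]_(w in good_at q C t) K w)%E by exact: integral_ge0.
(* [Q + 1] in place of [Q] is strictly positive, so that the right-hand side is [+oo] wherever [K]
   is. *)
exists ((Q + 1) * fine (\int[P]_(w in good_at q C t) K w)%E); split.
  by rewrite mulr_ge0 ?fine_ge0// addr_ge0.
move=> n.
have qn : 0 < (Q + 1) * (q ^+ 2) ^+ n by rewrite mulr_gt0 ?exprn_gt0//; lra.
have -> : (((Q + 1) * fine (\int[P]_(w in good_at q C t) K w)%E * (q ^+ 2) ^+ n)%:E =
    ((Q + 1) * (q ^+ 2) ^+ n)%:E * \int[P]_(w in good_at q C t) K w)%E.
  by rewrite mulrAC EFinM fineK// ge0_fin_numE.
rewrite -ge0_integralZl//; last 2 first.
- exact: measurable_funTS.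
- by rewrite lee_fin ltW.
apply: ge0_le_integral => //.
- by move=> w _; rewrite lee_fin powR_ge0.
- by apply: measurable_funTS; exact: measurable_distp_pullback_limit.
- by apply: measurable_funTS; exact: emeasurable_funM.
move=> w _; have := K0 w; case KE : (K w) => [k| |]// k0; last first.
  by rewrite gt0_muley ?lte_fin// leey.
rewrite -EFinM lee_fin mulrC mulrA.
apply: le_trans (HQ (fun n => fcomp (t - n%:Z + 1) n x0 w) k k0 _ n) _.
  by move=> m; have := HK m w; rewrite KE -EFinM lee_fin.
apply: ler_wpM2r; first by rewrite exprn_ge0// ltW.
by apply: ler_wpM2l => //; rewrite lerDl.
Qed.

(** On the good event, runs from [x] and from [x0] merge at rate [(q ^+ 4) ^+ n], faster than the
    rate kept for the limit; this is why one limit serves all starting points. *)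
Lemma limit_good_from q C t x : 0 < q -> q < 1 -> 0 <= C -> exists L, 0 <= L /\ forall n,
  (\int[P]_(w in good_at q C t) (dist (fcomp (t - n%:Z + 1)%R n x w) (pullback_limit t w) `^ p)%:E <=
   (L * (q ^+ 2) ^+ n)%:E)%E.
Proof.
move=> q0 q1 C0; have [L [L0 HL]] := limit_good t q0 q1 C0.
have ZA := Zevent_goodt q C t; have mA := measurable_Zevent ZA.
have p0 : 0 <= p by exact: le_trans hp.
exists (2 `^ p * (C * dist x x0 `^ p + L)); split.
  by rewrite mulr_ge0 ?powR_ge0// addr_ge0// mulr_ge0// powR_ge0.
move=> n.
apply: (@le_trans _ _ (\int[P]_(w in good_at q C t) ((2 `^ p)%:E *
   ((dist (fcomp (t - n%:Z + 1)%R n x w) (fcomp (t - n%:Z + 1)%R n x0 w) `^ p)%:E +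
    (dist (fcomp (t - n%:Z + 1)%R n x0 w) (pullback_limit t w) `^ p)%:E)))%E).
  apply: ge0_le_integral => //.
  - by move=> w _; rewrite lee_fin powR_ge0.
  - by apply: measurable_funTS; exact: measurable_distp_pullback_limit.
  - apply: measurable_funTS; apply: emeasurable_funM => //.
    apply: emeasurable_funD; last exact: measurable_distp_pullback_limit.
    by apply/measurable_EFinP; apply: (measurable_fun_distp HE); exact: measurable_fcomp.
  - move=> w _; rewrite -EFinD -EFinM lee_fin; apply: le_trans (powR_add_le _ _ p0).
    + rewrite ge0_ler_powR ?nnegrE ?addr_ge0 ?(dist_ge0 HE)//.
      exact: (dist_triangle HE).
    + exact: (dist_ge0 HE).
    + exact: (dist_ge0 HE).
have mdd : measurable_fun setT (fun w =>
    (dist (fcomp (t - n%:Z + 1)%R n x w) (fcomp (t - n%:Z + 1)%R n x0 w) `^ p)%:E).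
  by apply/measurable_EFinP; apply: (measurable_fun_distp HE); exact: measurable_fcomp.
rewrite ge0_integralZl//=; last 2 first.
- by apply: measurable_funTS; apply: emeasurable_funD => //; exact: measurable_distp_pullback_limit.
- by move=> w _; rewrite adde_ge0// lee_fin powR_ge0.
rewrite -mulrA EFinM; apply: lee_wpmul2l; first by rewrite lee_fin powR_ge0.
rewrite ge0_integralD//=; last 4 first.
- by move=> w _; rewrite lee_fin powR_ge0.
- exact: measurable_funTS.
- by move=> w _; rewrite lee_fin powR_ge0.
- by apply: measurable_funTS; exact: measurable_distp_pullback_limit.
rewrite mulrDl EFinD; apply: leeD (HL n).
apply: le_trans (@contraction_good q C t n _ (fun=> x) (fun=> x0) q0 C0 ZA _ _ _) _ => //.
rewrite integral_cst//.
apply: (@le_trans _ _ ((C * (q ^+ 4) ^+ n)%:E * (dist x x0 `^ p)%:E)%E).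
  apply: lee_wpmul2l; first by rewrite lee_fin mulr_ge0// exprn_ge0// exprn_ge0// ltW.
  rewrite -[leRHS]mule1; apply: lee_wpmul2l; first by rewrite lee_fin powR_ge0.
  exact: probability_le1.
rewrite -EFinM lee_fin mulrAC ler_wpM2l ?mulr_ge0 ?powR_ge0//.
rewrite -!exprM ler_wiXn2l// ?ltW//.
by rewrite leq_mul2r orbC.
Qed.

(** * From bounds on good events to almost sure statements *)

Section AlmostSure.
Variables (q : R).
Hypotheses (q0 : 0 < q) (q1 : q < 1).
Hypothesis good_q : {ae path_law P Z, forall z, exists C : nat, good_env q C%:R z}.

Let q20 : 0 < q ^+ 2. Proof. by rewrite exprn_gt0. Qed.
Let q21 : q ^+ 2 < 1. Proof. by rewrite expr2 mulr_ilt1// ltW. Qed.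

(** Localisation: the constant [C] of an environment is finite but random, and with natural values
    there are only countably many events to treat. *)
Lemma ae_goodt t (Q : Omega -> Prop) :
  (forall C : nat, {ae P, forall w, good_at q C%:R t w -> Q w}) ->
  {ae P, forall w, Q w}.
Proof.
move=> /ae_foralln HQ; apply: filterS2 (goodt_ae t good_q) HQ => w [C gC] H.
exact: H gC.
Qed.

Lemma measurable_cond_exp J W g :
  cond_exp_version P (sigma_gen (fun t w => Z t w) J) W g -> measurable_fun setT g.
Proof.
move=> [mg _ _] _ B mB; rewrite setTI; apply: (@sigma_gen_measurable _ _ _ _ Z J).
exact: mg.
Qed.

(** The limit is known to have a p-th moment on good events only; these lie in sigma(Z), so there
    any version [g] has the same, finite, integral. *)
Lemma cond_exp_pullback_limit_finite t g :
  cond_exp_version P (sigma_gen (fun t w => Z t w) setT)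
    (fun w => (dist (pullback_limit t w) x0 `^ p)%:E) g ->
  {ae P, forall w, (g w < +oo)%E}.
Proof.
move=> gP; have mg := measurable_cond_exp gP; case: gP => _ g0 gE.
apply: (@ae_goodt t) => C.
have ZA := Zevent_goodt q C%:R t; have mA := measurable_Zevent ZA.
have [L [L0 HL]] := limit_good t q0 q1 (ler0n R C).
have ig : P.-integrable (good_at q C%:R t) g.
  apply/integrableP; split; first exact: measurable_funTS.
  under eq_integral do rewrite gee0_abs//.
  rewrite gE; last exact: sigma_gen_Zevent.
  (* At index 0 no map is applied, and the bound concerns the distance from [x0] itself to the
     limit. *)
  have := HL 0%N; rewrite expr0 mulr1 /=.
  under eq_integral do rewrite (distC HE).
  by move=> /le_lt_trans; apply; exact: ltry.
apply: filterS (integrable_ae mA ig) => w H Aw.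
by have := H Aw; rewrite ge0_fin_numE.
Qed.

Lemma distp_cvg0 (u : nat -> E) (l : E) :
  (fun n => (dist (u n) l `^ p)%:E) @ \oo --> 0%E -> (fun n => dist (u n) l) @ \oo --> 0.
Proof.
move=> H; have p0 : 0 < p by exact: lt_le_trans hp.
apply/cvgrPdist_lt => e e0.
have /fine_cvgP[_ /cvgrPdist_lt/(_ (e `^ p) (powR_gt0 _ e0))] := H.
apply: filterS => n /=; rewrite !sub0r !normrN ger0_norm ?powR_ge0//.
rewrite ger0_norm ?(dist_ge0 HE)// => h; rewrite ltNge; apply/negP => le.
move: h; apply/negP; rewrite -leNgt ge0_ler_powR ?nnegrE ?(dist_ge0 HE)//; exact: ltW.
Qed.

(** The run from time [t - s%:Z] to [t] has [s.+1] maps, one more than its index; the rate at [s.+1]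
    is weakened to the rate at [s]. *)
Lemma limit_good_shift C t x : exists L, 0 <= L /\ forall s : nat,
  (\int[P]_(w in good_at q C%:R t)
    (dist (fcomp (t - s%:Z)%R s.+1 x w) (pullback_limit t w) `^ p)%:E <= (L * (q ^+ 2) ^+ s)%:E)%E.
Proof.
have [L [L0 HL]] := limit_good_from t x q0 q1 (ler0n R C).
exists L; split; first exact: L0.
move=> s; have := HL s.+1; rewrite (subz_succ t s) => /le_trans; apply.
rewrite lee_fin ler_wpM2l// exprS ler_piMl ?exprn_ge0// ltW//.
Qed.

(** Over the good event [g s] has the same integral as the distance it conditions, so the passage
    from means to almost sure convergence applies to [g s] itself. *)
Lemma cond_exp_cvg0 t x (g : nat -> Omega -> \bar R) :
  (forall s : nat, cond_exp_version P (sigma_gen (fun t w => Z t w) setT)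
    (fun w => (dist (fcomp (t - s%:Z) s.+1 x w) (pullback_limit t w) `^ p)%:E) (g s)) ->
  {ae P, forall w, (fun s => g s w) @ \oo --> 0%E}.
Proof.
move=> gP; apply: (@ae_goodt t) => C.
have ZA := Zevent_goodt q C%:R t; have mA := measurable_Zevent ZA.
have [L [L0 HL]] := limit_good_shift C t x.
apply: (geometric_ae_cvg0 mA q0 q1 L0).
- by move=> n; exact: measurable_cond_exp (gP n).
- by move=> n w; have [] := gP n.
- move=> n; have [_ _ ->] := gP n; last exact: sigma_gen_Zevent.
  exact: HL.
Qed.

Lemma fcomp_cvg t x :
  {ae P, forall w, (fun s : nat => dist (fcomp (t - s%:Z) s.+1 x w) (pullback_limit t w)) @ \oo --> 0}.
Proof.
apply: (@ae_goodt t) => C.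
have ZA := Zevent_goodt q C%:R t; have mA := measurable_Zevent ZA.
have [L [L0 HL]] := limit_good_shift C t x.
have H := geometric_ae_cvg0 mA q0 q1 L0 (fun s : nat => measurable_distp_pullback_limit t (t - s%:Z) s.+1 x) _ HL.
apply: filterS (H _); last by move=> n w; rewrite lee_fin powR_ge0.
by move=> w Hw Aw; apply: distp_cvg0; exact: Hw.
Qed.

(** * Comparison of a stationary solution with the pullback limit *)

Section Uniqueness.
Variable Y : int -> Omega -> E.
Hypothesis Ypast : forall t (B : set E), measurable B ->
  sigma_gen2 (fun j w => Z j w) (fun j w => eps j w) [set j | j <= t] (Y t @^-1` B).
Hypothesis YZstat : stationary P (fun t w => (Y t w, Z t w)).
Hypothesis Yrec : forall t w, Y t w = F (Y (t - 1) w, Z (t - 1) w, eps t w).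

Lemma measurable_past_Y t : measurable_fun setT (Y t : past t -> E).
Proof.
move=> _ B /(@Ypast t B); rewrite setTI.
suff : sigma_gen2 (fun j w => Z j w) (fun j w => eps j w) [set j | j <= t] `<=`
    (measurable : set (set (past t))) by apply.
apply: smallest_sub; first exact: (@sigma_algebra_measurable _ (past t)).
move=> _ [j [jt [[C [mC ->]]|[C [mC ->]]]]].
  by have := @measurable_past_Z _ _ _ _ _ _ Z eps t j measurableT C mC; rewrite setTI.
by have := @measurable_past_eps _ _ _ _ _ _ Z eps t j jt measurableT C mC; rewrite setTI.
Qed.

Let mYZ t : measurable_fun setT (fun w => (Y t w, Z t w)).
Proof.
apply: measurable_fun_pair; last exact: measurable_funPT.
exact: (measurable_past_fun (@measurable_past_Y t)).
Qed.

Definition YZ (t : int) (w : Omega) : E * T1 := (Y t w, Z t w).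
HB.instance Definition _ t := isMeasurableFun.Build _ _ _ _ (YZ t) (mYZ t).
Definition mfunYZ (t : int) : {mfun Omega >-> (E * T1)%type} := YZ t.

(** Joint stationarity moves the start of a run to time 0, the time at which the conditional moment
    of [Y] is assumed finite. *)
Lemma integral_Y_shift (B : set (pathType T1)) (s : int) : measurable B ->
  (\int[P]_(w in [set w | B (shiftn s (pathRV Z w))]) (dist (Y s w) x0 `^ p)%:E =
   \int[P]_(w in [set w | B (pathRV Z w)]) (dist (Y 0 w) x0 `^ p)%:E)%E.
Proof.
move=> mB.
pose B' : set (pathType (E * T1)%type) := [set y | B (fun j => (y j).2)].
have mB' : measurable B'.
  rewrite -[X in measurable X]setTI.
  have : measurable_fun setT
      ((fun y j => (y j).2) : pathType (E * T1)%type -> pathType T1).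
    apply: measurable_fun_path => j.
    exact: (measurableT_comp measurable_snd (@measurable_path_eval _ (E * T1)%type j)).
  exact.
pose f (y : pathType (E * T1)%type) := (\1_B' y * dist (y 0).1 x0 `^ p)%:E.
have mf : measurable_fun setT f.
  apply/measurable_EFinP; apply: measurable_funM; first exact: measurable_indic.
  apply: (measurable_fun_distp HE); last exact: measurable_cst.
  exact: (measurableT_comp measurable_fst (@measurable_path_eval _ (E * T1)%type 0)).
have f0 y : (0 <= f y)%E by rewrite lee_fin mulr_ge0// powR_ge0.
rewrite integral_setE_indic [RHS]integral_setE_indic.
transitivity (\int[P]_w f (shiftn s (pathRV mfunYZ w)))%E.
  by apply: eq_integral => w _; rewrite /f /shiftn /pathRV /= add0r !indicE.
rewrite (@integral_shiftn_path _ _ _ P _ _ mfunYZ s f YZstat mf f0).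
by apply: eq_integral => w _; rewrite /f !indicE.
Qed.

Lemma Y_fcomp s n w : Y (s - 1 + n%:Z) w = fcomp s n (Y (s - 1) w) w.
Proof.
elim: n => [|n IH] /=; first by rewrite addr0.
rewrite -IH Yrec /frand; rewrite (_ : s - 1 + n.+1%:Z = s + n%:Z); last first.
  by rewrite -addn1 PoszD addrA addrAC subrK.
by rewrite (_ : s + n%:Z - 1 = s - 1 + n%:Z)// addrAC.
Qed.

Lemma Y_fcomp_back t n w : Y t w = fcomp (t - n%:Z + 1) n (Y (t - n%:Z) w) w.
Proof. by have := Y_fcomp (t - n%:Z + 1) n w; rewrite addrK subrK. Qed.

Variable g : Omega -> \bar R.
Hypothesis gP : cond_exp_version P (sigma_gen (fun t w => Z t w) [set j | j <= 0])
                    (fun w => (dist (Y 0 w) x0 `^ p)%:E) g.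
Hypothesis goo : {ae P, forall w, (g w < +oo)%E}.

(** As a set of paths, the level event of [g] can be transported to another time by a shift. *)
Lemma g_level (M : nat) : exists2 B, path_measurable B &
  [set w | (g w <= M%:R%:E)%E] = pathRV Z @^-1` B.
Proof.
have [mg _ _] := gP; apply: (@sigma_gen_path _ _ _ _ Z [set j | j <= 0]).
have -> : [set w | (g w <= M%:R%:E)%E] = g @^-1` `]-oo, M%:R%:E]%classic.
  by apply/seteqP; split => w /=; rewrite in_itv.
apply: mg; exact: emeasurable_itv.
Qed.

(** [Y t] and the approximation apply the same [n] maps, to [Y (t - n%:Z)] and to [x0]. On the
    shifted level event the starting distance has integral at most [M]: stationarity moves it to
    time 0, where [g] may replace it. Hence one [L] works for all [n]. *)
Lemma Y_close (M C : nat) t (B : set (pathType T1)) : measurable B ->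
  [set w | (g w <= M%:R%:E)%E] = pathRV Z @^-1` B ->
  exists L, 0 <= L /\ forall n : nat,
  (\int[P]_(w in good_at q C%:R t `&` [set w | B (shiftn (t - n%:Z)%R (pathRV Z w))])
     (dist (pullback_limit t w) (Y t w) `^ p)%:E <= (L * (q ^+ 2) ^+ n)%:E)%E.
Proof.
move=> mB BE; have [L [L0 HL]] := limit_good t q0 q1 (ler0n R C).
have p0 : 0 <= p by exact: le_trans hp.
exists (2 `^ p * (L + C%:R * M%:R)); split.
  by rewrite mulr_ge0 ?powR_ge0// addr_ge0// mulr_ge0.
move=> n; set D := [set w | _]; set A := _ `&` D.
have ZD : Zevent D.
  exists (shiftn (t - n%:Z) @^-1` B) => //.
  by have := @measurable_shiftn _ T1 (t - n%:Z) measurableT _ mB; rewrite setTI.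
have ZA : Zevent A by apply: ZeventI => //; exact: Zevent_goodt.
have mA := measurable_Zevent ZA; have mD := measurable_Zevent ZD.
have mG := measurable_Zevent (Zevent_goodt q C%:R t).
have mYt s := measurable_past_fun (@measurable_past_Y s).
have m1 := measurable_distp_pullback_limit t (t - n%:Z + 1) n x0.
have m2 : measurable_fun setT (fun w => (dist (fcomp (t - n%:Z + 1) n x0 w) (Y t w) `^ p)%:E).
  by apply/measurable_EFinP; apply: (measurable_fun_distp HE) => //; exact: measurable_fcomp.
apply: (@le_trans _ _ (\int[P]_(w in A) ((2 `^ p)%:E *
   ((dist (fcomp (t - n%:Z + 1)%R n x0 w) (pullback_limit t w) `^ p)%:E +
    (dist (fcomp (t - n%:Z + 1)%R n x0 w) (Y t w) `^ p)%:E)))%E).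
  apply: ge0_le_integral => //.
  - by move=> w _; rewrite lee_fin powR_ge0.
  - apply: measurable_funTS; apply/measurable_EFinP.
    by apply: (measurable_fun_distp HE) => //; exact: measurable_pullback_limit.
  - by apply: measurable_funTS; apply: emeasurable_funM => //; exact: emeasurable_funD.
  - move=> w _; rewrite -EFinD -EFinM lee_fin; apply: le_trans (powR_add_le _ _ p0).
    + rewrite ge0_ler_powR ?nnegrE ?addr_ge0 ?(dist_ge0 HE)//.
      rewrite (distC HE _ (pullback_limit t w)); exact: (dist_triangle HE).
    + exact: (dist_ge0 HE).
    + exact: (dist_ge0 HE).
rewrite ge0_integralZl//=; last 2 first.
- by apply: measurable_funTS; exact: emeasurable_funD.
- by move=> w _; rewrite adde_ge0// lee_fin powR_ge0.
rewrite -mulrA EFinM; apply: lee_wpmul2l; first by rewrite lee_fin powR_ge0.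
rewrite ge0_integralD//=; last 4 first.
- by move=> w _; rewrite lee_fin powR_ge0.
- exact: measurable_funTS.
- by move=> w _; rewrite lee_fin powR_ge0.
- exact: measurable_funTS.
rewrite mulrDl EFinD; apply: leeD.
  apply: le_trans (HL n); apply: ge0_subset_integral => //.
  - exact: measurable_funTS.
  - by move=> w _; rewrite lee_fin powR_ge0.
  - exact: subIsetl.
under eq_integral do rewrite (Y_fcomp_back t n).
have AG : A `<=` good_at q C%:R t by exact: subIsetl.
apply: le_trans (@contraction_good q C%:R t n A (fun=> x0) (Y (t - n%:Z)) q0
  (ler0n _ _) ZA AG (@measurable_cst _ _ _ _ _ x0) (@measurable_past_Y _)) _.
apply: (@le_trans _ _ ((C%:R * (q ^+ 4) ^+ n)%:E * M%:R%:E)%E); last first.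
  rewrite -EFinM lee_fin mulrAC ler_wpM2l ?mulr_ge0//.
  by rewrite -!exprM ler_wiXn2l// ?ltW// leq_mul2r orbC.
apply: lee_wpmul2l; first by rewrite lee_fin mulr_ge0// exprn_ge0// exprn_ge0// ltW.
under eq_integral do rewrite (distC HE).
apply: (@le_trans _ _ (\int[P]_(w in D) (dist (Y (t - n%:Z)%R w) x0 `^ p)%:E)%E).
  apply: ge0_subset_integral => //.
  - apply: measurable_funTS; apply/measurable_EFinP.
    by apply: (measurable_fun_distp HE) => //; exact: measurable_cst.
  - by move=> w _; rewrite lee_fin powR_ge0.
  - exact: subIsetr.
rewrite integral_Y_shift//.
have [mg g0 gE] := gP; have mg' := measurable_cond_exp gP.
have -> : [set w | B (pathRV Z w)] = [set w | (g w <= M%:R%:E)%E] by rewrite BE.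
have ml : measurable [set w | (g w <= M%:R%:E)%E].
  by rewrite BE -[X in measurable X]setTI; exact: measurable_pathRV.
rewrite -gE; last first.
  have -> : [set w | (g w <= M%:R%:E)%E] = g @^-1` `]-oo, M%:R%:E]%classic.
    by apply/seteqP; split => w /=; rewrite in_itv.
  apply: mg; exact: emeasurable_itv.
apply: (@le_trans _ _ (\int[P]_(w in [set w | (g w <= M%:R%:E)%E]) M%:R%:E)%E).
  by apply: ge0_le_integral => //; exact: measurable_funTS.
rewrite integral_cst// -[leRHS]mule1; apply: lee_wpmul2l; first by rewrite lee_fin.
exact: probability_le1.
Qed.

(** [C] and [M] are fixed first, each leaving out probability at most [e / 3]; then [n] is taken
    large for the resulting [L], and Markov's inequality bounds what remains. Moving the level event
    to [t - n%:Z] keeps its probability, as [Z] is stationary. *)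
Lemma Y_level_eq0 t (eta : R) : 0 < eta ->
  P [set w | eta <= dist (pullback_limit t w) (Y t w) `^ p] = 0%E.
Proof.
move=> eta0; set S := mkset _.
have mYt s := measurable_past_fun (@measurable_past_Y s).
have mh : measurable_fun setT (fun w => dist (pullback_limit t w) (Y t w) `^ p).
  by apply: (measurable_fun_distp HE) => //; exact: measurable_pullback_limit.
have mS : measurable S.
  rewrite (_ : S = (fun w => dist (pullback_limit t w) (Y t w) `^ p) @^-1` `[eta, +oo[).
    by rewrite -[X in measurable X]setTI; exact: mh.
  by apply/seteqP; split => w /=; rewrite in_itv/= andbT.
apply/eqP; rewrite eq_le measure_ge0 andbT; apply/lee_addgt0Pr => e e0; rewrite add0e.
have e3 : 0 < e / 3 by lra.
have mGt (C : nat) : measurable (good_at q C%:R t).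
  exact: (measurable_Zevent (Zevent_goodt q C%:R t)).
have [C HC] := ae_exhaustion mGt (@goodt_nd q t q0) (goodt_ae t good_q) e3.
have [mg g0 gE] := gP; have mg' := measurable_cond_exp gP.
pose G (M : nat) := [set w | (g w <= M%:R%:E)%E].
have mG M : measurable (G M).
  have [B mB BE] := g_level M.
  by rewrite /G BE -[X in measurable X]setTI; exact: measurable_pathRV.
have [M HM] : exists M, (P (~` G M) <= (e / 3)%:E)%E.
  apply: ae_exhaustion => //.
  - move=> m n mn w /= h; apply: le_trans h _.
    by rewrite lee_fin ler_nat.
  - apply: filterS goo => w gw; exists (Num.bound (fine (g w))).
    have gf : g w \is a fin_num by rewrite ge0_fin_numE.
    by rewrite /G/= -(fineK gf) lee_fin; apply/ltW/archi_boundP; exact: fine_ge0.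
have [B mB BE] := g_level M.
have [L [L0 HL]] := Y_close C t mB BE.
have [n Hn] : exists n, L * (q ^+ 2) ^+ n / eta < e / 3.
  have : geometric (L / eta) (q ^+ 2) n @[n --> \oo] --> (0 : R).
    by apply: cvg_geometric; rewrite ger0_norm// ltW.
  move/cvgrPdist_lt => /(_ _ e3)[N _ HN]; exists N.
  have := HN N (leqnn N); rewrite /= sub0r normrN ger0_norm.
    by rewrite mulrAC.
  by rewrite mulr_ge0 ?divr_ge0 ?exprn_ge0// ltW.
set D := [set w | B (shiftn (t - n%:Z) (pathRV Z w))].
have ZD : Zevent D.
  exists (shiftn (t - n%:Z) @^-1` B) => //.
  by have := @measurable_shiftn _ T1 (t - n%:Z) measurableT _ mB; rewrite setTI.
have mD := measurable_Zevent ZD.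
have PD : (P (~` D) <= (e / 3)%:E)%E.
  apply: le_trans HM; rewrite le_eqVlt; apply/orP; left; apply/eqP.
  rewrite !probability_setC//; congr (1 - _)%E.
  by rewrite /G BE; exact: (stationary_shiftn HZstat).
have mA : measurable (good_at q C%:R t `&` D) by exact: measurableI.
have PA : (P (S `&` (good_at q C%:R t `&` D)) <= (e / 3)%:E)%E.
  apply: le_trans (_ : _ <= (L * (q ^+ 2) ^+ n / eta)%:E)%E _; last by rewrite lee_fin ltW.
  rewrite -(@lee_pmul2l _ eta%:E) ?lte_fin// -EFinM mulrC divfK ?gt_eqF//.
  apply: le_trans (HL n); rewrite -integral_cst; last exact: measurableI.
  apply: (@le_trans _ _ (\int[P]_(w in S `&` (good_at q C%:R t `&` D))
     (dist (pullback_limit t w) (Y t w) `^ p)%:E)%E).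
    apply: ge0_le_integral => //.
    - exact: measurableI.
    - by move=> w _; rewrite lee_fin ltW.
    - by apply: measurable_funTS; exact/measurable_EFinP.
    - by move=> w [Sw _]; rewrite lee_fin.
  apply: ge0_subset_integral => //.
  - exact: measurableI.
  - by apply: measurable_funTS; exact/measurable_EFinP.
  - by move=> w _; rewrite lee_fin powR_ge0.
apply: (@le_trans _ _ (P ((S `&` (good_at q C%:R t `&` D)) `|`
    (~` good_at q C%:R t `|` ~` D)))).
  apply: le_measure; rewrite ?inE//.
    by apply: measurableU; [exact: measurableI|apply: measurableU; exact: measurableC].
  move=> w Sw; have [Aw|nA] := pselect (good_at q C%:R t w); last by right; left.
  by have [Dw|nD] := pselect (D w); [left|right; right].
apply: le_trans (measureU2 _ _ _) _.
- exact: measurableI.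
- by apply: measurableU; exact: measurableC.
apply: (@le_trans _ _ ((e / 3)%:E + ((e / 3)%:E + (e / 3)%:E))%E).
  apply: leeD => //; apply: le_trans (measureU2 _ _ _) _; [exact: measurableC|exact: measurableC|].
  exact: leeD.
by rewrite -!EFinD lee_fin; lra.
Qed.

Lemma stationary_solution_unique t : P [set w | Y t w <> pullback_limit t w] = 0%E.
Proof.
have mYt s := measurable_past_fun (@measurable_past_Y s).
have p0 : 0 < p by exact: lt_le_trans hp.
pose S (k : nat) := [set w | k.+1%:R^-1 <= dist (pullback_limit t w) (Y t w) `^ p].
have mh : measurable_fun setT (fun w => dist (pullback_limit t w) (Y t w) `^ p).
  by apply: (measurable_fun_distp HE) => //; exact: measurable_pullback_limit.
have mS k : measurable (S k).
  rewrite (_ : S k = (fun w => dist (pullback_limit t w) (Y t w) `^ p) @^-1` `[k.+1%:R^-1, +oo[).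
    by rewrite -[X in measurable X]setTI; exact: mh.
  by apply/seteqP; split => w /=; rewrite in_itv/= andbT.
have -> : [set w | Y t w <> pullback_limit t w] = \bigcup_k S k.
  apply/seteqP; split => w /=.
    move=> YX; have d0 : 0 < dist (pullback_limit t w) (Y t w) `^ p.
      rewrite powR_gt0// lt_neqAle (dist_ge0 HE) andbT eq_sym.
      by apply/eqP => /(dist_eq0P HE) XY; exact: YX.
    by have [k hk] := invSn_lt d0; exists k => //; exact: ltW.
  move=> [k _] + YX; rewrite /S/= YX (distxx HE) powR0 ?gt_eqF//.
  by rewrite leNgt invr_gt0 ltr0n.
apply/(@negligibleP _ _ _ P); first exact: bigcupT_measurable.
apply: negligible_bigcup => k; apply/negligibleP => //.
by apply: Y_level_eq0; rewrite invr_gt0 ltr0n.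
Qed.

End Uniqueness.

End AlmostSure.

End Main.

(** * Ergodicity of the joint process *)

Section Joint.
Context (R : realType) dO (Omega : measurableType dO) (P : probability Omega R).
Context d1 (T1 : measurableType d1) d2 (T2 : measurableType d2).
Variable Z : int -> {mfun Omega >-> T1}.
Variable eps : int -> {mfun Omega >-> T2}.
Hypothesis HZstat : stationary P (fun t w => Z t w).
Hypothesis HZerg : ergodic P (fun t w => Z t w).
Hypothesis Heps_indep : mutually_independent P (fun t w => eps t w).
Hypothesis Heps_id : identically_distributed P (fun t w => eps t w).
Hypothesis HepsZ : independent_sigma P (sigma_gen (fun t w => eps t w) setT)
                               (sigma_gen (fun t w => Z t w) setT).

Notation joint := (pathType T1 * pathType T2)%type.
Notation mu := (path_law P Z).
Notation nu := (path_law P eps).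

Lemma iid_stationary : stationary P (fun t w => eps t w).
Proof.
move=> B mB.
apply: (@setI_closed_measure_eq _ _ _ _ (path_law P (fun t => eps (t + 1))) nu
  (@path_measurable_fincyls _ T2) (@fincyls_setI _ T2 setT) (@fincyls_setT _ T2 setT) _ _ B mB).
  by rewrite (le_lt_trans (probability_le1 _ _)) ?ltry.
move=> _ [s [A [us _ mA ->]]]; apply: etrans (esym (fincyl_law Heps_indep Heps_id us mA)).
have us1 : uniq [seq t + 1 | t <- s].
  by rewrite map_inj_uniq// => x y /addIr.
transitivity (nu (fincyl [seq t + 1 | t <- s] (fun t => A (t - 1)))).
  congr (P _); apply/seteqP; split => w /= H t.
    by move=> /mapP[r rs ->]; rewrite addrK; exact: H.
  by move=> ts; have := H (t + 1) (map_f _ ts); rewrite addrK.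
rewrite (fincyl_law Heps_indep Heps_id us1)// big_map.
by congr EFin; apply: eq_bigr => t _; rewrite addrK.
Qed.

Definition joint_shift (t : int) (x : joint) : joint := (shiftn t x.1, shiftn t x.2).

Lemma joint_shiftD s t x : joint_shift s (joint_shift t x) = joint_shift (s + t) x.
Proof. by rewrite /joint_shift/= !shiftnD. Qed.

Lemma joint_shift0 x : joint_shift 0 x = x.
Proof. by case: x => z e; rewrite /joint_shift !shiftn0. Qed.

Lemma measurable_joint_shift t : measurable_fun setT (joint_shift t).
Proof.
apply: (@measurable_fun_pair _ _ _ _ (pathType T1) (pathType T2)
  (fun x : joint => shiftn t x.1) (fun x : joint => shiftn t x.2)).
  exact: (measurableT_comp (@measurable_shiftn _ T1 t) measurable_fst).
exact: (measurableT_comp (@measurable_shiftn _ T2 t) measurable_snd).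
Qed.

Definition jointRV (w : Omega) : joint := (pathRV Z w, pathRV eps w).

Lemma measurable_jointRV : measurable_fun setT jointRV.
Proof.
exact: (measurable_fun_pair (measurable_pathRV Z) (measurable_pathRV eps)).
Qed.

HB.instance Definition _ :=
  isMeasurableFun.Build _ _ _ _ jointRV measurable_jointRV.

Definition shifted_jointRV t (w : Omega) : joint := joint_shift t (jointRV w).

Lemma measurable_shifted_jointRV t : measurable_fun setT (shifted_jointRV t).
Proof. exact: (measurableT_comp (@measurable_joint_shift t) measurable_jointRV). Qed.

HB.instance Definition _ t := isMeasurableFun.Build _ _ _ _ (shifted_jointRV t)
  (@measurable_shifted_jointRV t).

Definition jointlaw := distribution P jointRV.
HB.instance Definition _ := Probability.on jointlaw.

(** Two facts at once: the joint law is a product ([t = 0]), and it is invariant under the joint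
    shift. *)
Lemma shifted_joint_law t (B : set joint) : measurable B ->
  P [set w | B (joint_shift t (jointRV w))] = (mu \x nu)%E B.
Proof.
move=> mB; apply/esym.
apply: (@product_measure_unique _ _ _ _ _ mu nu (distribution P (shifted_jointRV t))) => //.
move=> A C mA mC.
have mA' := @measurable_shiftn _ T1 t measurableT _ mA.
have mC' := @measurable_shiftn _ T2 t measurableT _ mC.
rewrite !setTI in mA' mC'.
apply: etrans (path_law_independent HepsZ mA' mC') _.
by rewrite (stationary_shiftn_law HZstat)// (stationary_shiftn_law iid_stationary).
Qed.

Lemma jointlawE (B : set joint) : measurable B -> jointlaw B = (mu \x nu)%E B.
Proof.
move=> mB; rewrite -(shifted_joint_law 0 mB); congr (P _).
by apply/seteqP; split => w /=; rewrite joint_shift0.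
Qed.

Lemma jointlaw_joint_shift t (B : set joint) : measurable B ->
  jointlaw (joint_shift t @^-1` B) = jointlaw B.
Proof. by move=> mB; rewrite (jointlawE mB) -(shifted_joint_law t mB). Qed.

Lemma integral_jointlaw (f : joint -> \bar R) : measurable_fun setT f ->
  (forall x, 0 <= f x)%E ->
  (\int[jointlaw]_x f x = \int[mu]_z \int[nu]_e f (z, e))%E.
Proof.
move=> mf f0; rewrite -fubini_tonelli1//.
by apply: eq_measure_integral => A mA _; exact: jointlawE.
Qed.

(** * Asymptotic conditional independence of an event and its shifts, given the environment *)

Definition section_mass (B : set joint) (z : pathType T1) : \bar R := nu (xsection B z).

Lemma measurable_section_mass B : measurable B -> measurable_fun setT (section_mass B).
Proof. exact: measurable_fun_xsection. Qed.

Lemma section_mass_ge0 B z : (0 <= section_mass B z)%E.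
Proof. exact: measure_ge0. Qed.

Lemma section_mass_le1 B z : measurable B -> (section_mass B z <= 1)%E.
Proof. by move=> mB; apply: probability_le1; exact: measurable_xsection. Qed.

Lemma integral_section (B : set joint) (k : pathType T1 -> \bar R) : measurable B ->
  measurable_fun setT k -> (forall z, 0 <= k z)%E ->
  (\int[jointlaw]_(x in B) k x.1 = \int[mu]_z (section_mass B z * k z))%E.
Proof.
move=> mB mk k0; rewrite integral_mkcond.
have -> : ((fun x : joint => k x.1) \_ B) = (fun x => (\1_B x)%:E * k x.1)%E.
  by apply/funext => x; rewrite patchE indicE; case: ifP => _; rewrite ?mul1e ?mul0e.
rewrite integral_jointlaw; last 2 first.
- apply: emeasurable_funM; first by apply/measurable_EFinP; exact: measurable_indic.
  exact: (measurableT_comp mk measurable_fst).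
- by move=> x; rewrite mule_ge0// lee_fin indicE.
apply: eq_integral => z _ /=.
have mBz : measurable (xsection B z) by exact: measurable_xsection.
have -> : (fun e => (\1_B (z, e))%:E * k z)%E = (fun e => (\1_(xsection B z) e)%:E * k z)%E.
  by apply/funext => e; rewrite !indicE mem_xsection.
rewrite ge0_integralZr//.
- by rewrite integral_indic// setIT.
- by apply/measurable_EFinP; exact: measurable_indic.
Qed.

(** With theta the joint shift by [t], [gap_l] is the probability of [B] and theta^-1 C together,
    and [gap_r] is what it would be under conditional independence given [Z]: as the law is a
    product, [section_mass C (shiftn t z)] is P(theta^-1 C | Z = z). *)
Definition gap_l (t : int) (C B : set joint) : R :=
  fine (jointlaw (B `&` joint_shift t @^-1` C)).

Definition gap_r (t : int) (C B : set joint) : R :=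
  fine (\int[jointlaw]_(x in B) section_mass C (shiftn t x.1))%E.

Let mjoint_shift t C : measurable C -> measurable (joint_shift t @^-1` C).
Proof.
by move=> mC; have := @measurable_joint_shift t measurableT C mC; rewrite setTI.
Qed.

Let mmass t C : measurable C ->
  measurable_fun setT (fun z : pathType T1 => section_mass C (shiftn t z)).
Proof.
move=> mC; exact: (measurableT_comp (measurable_section_mass mC) (@measurable_shiftn _ T1 t)).
Qed.

Let mmass1 t C : measurable C ->
  measurable_fun setT (fun x : joint => section_mass C (shiftn t x.1)).
Proof. by move=> mC; exact: (measurableT_comp (mmass t mC) measurable_fst). Qed.

Lemma gap_r_le t C B : measurable C -> measurable B ->
  (\int[jointlaw]_(x in B) section_mass C (shiftn t x.1) <= jointlaw B)%E.
Proof.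
move=> mC mB; rewrite -[leRHS]mul1e -integral_cst//; apply: ge0_le_integral => //.
- by apply: measurable_funTS; exact: mmass1.
- by move=> x _; exact: section_mass_le1.
Qed.

Lemma gap_r_fin t C B : measurable C -> measurable B ->
  (\int[jointlaw]_(x in B) section_mass C (shiftn t x.1))%E \is a fin_num.
Proof.
move=> mC mB; rewrite ge0_fin_numE; last by apply: integral_ge0 => x _; exact: section_mass_ge0.
by rewrite (le_lt_trans (gap_r_le t mC mB))// ltey_eq fin_num_measure.
Qed.

(** Exchanging the two events reverses time; this lets [gap_step], which enlarges the class of one
    of them, be applied to the other. *)
Lemma gap_sym t B C : measurable B -> measurable C ->
  gap_l t C B = gap_l (- t) B C /\ gap_r t C B = gap_r (- t) B C.
Proof.
move=> mB mC; split.
  rewrite /gap_l -(jointlaw_joint_shift (- t)); last by apply: measurableI => //; exact: mjoint_shift.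
  rewrite preimage_setI; congr (fine (jointlaw _)); rewrite setIC; congr (_ `&` _).
  by apply/seteqP; split => x; rewrite /preimage/= joint_shiftD subrr joint_shift0.
rewrite /gap_r (integral_section mB (mmass t mC)); last by move=> z; exact: section_mass_ge0.
rewrite (integral_section mC (mmass _ mB)); last by move=> z; exact: section_mass_ge0.
congr fine.
have mf : measurable_fun setT (fun z : pathType T1 =>
    section_mass B z * section_mass C (shiftn t z))%E.
  by apply: emeasurable_funM; [exact: measurable_section_mass|exact: mmass].
have f0 z : (0 <= section_mass B z * section_mass C (shiftn t z))%E.
  by rewrite mule_ge0//; exact: section_mass_ge0.
rewrite -(@ge0_integral_invariant _ _ _ mu (shiftn (- t)) (@measurable_shiftn _ T1 (- t))
  (@stationary_shiftn_law _ _ _ P _ _ Z HZstat (- t)) _ mf f0).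
by apply: eq_integral => z _; rewrite shiftnD subrr shiftn0 muleC.
Qed.

Definition rects : set (set joint) :=
  [set B | exists A U, [/\ measurable A, fincyls setT U & B = A `*` U]].

Lemma rects_setI : setI_closed rects.
Proof.
move=> _ _ [A [U [mA fU ->]]] [A' [U' [mA' fU' ->]]].
exists (A `&` A'), (U `&` U'); split; first exact: measurableI.
  exact: fincyls_setI.
by apply/seteqP; split => x [[? ?] [? ?]].
Qed.

Lemma rects_setT : rects setT.
Proof.
exists setT, setT; split => //; first exact: fincyls_setT.
by apply/seteqP; split.
Qed.

Lemma rects_measurable B : rects B -> measurable B.
Proof.
by move=> [A [U [mA /fincyls_measurable mU ->]]]; exact: measurableX.
Qed.

Lemma measurable_rects : (measurable : set (set joint)) = <<s rects >>.
Proof.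
apply/seteqP; split; last first.
  apply: smallest_sub; first exact: sigma_algebra_measurable.
  by move=> B; exact: rects_measurable.
rewrite measurable_prod_measurableType; apply: smallest_sub; first exact: smallest_sigma_algebra.
move=> _ [A mA [B mB <-]].
have mfst : measurable_fun setT ((fun x => x.1) : g_sigma_algebraType rects -> pathType T1).
  move=> _ C mC; rewrite setTI; apply: sub_sigma_algebra; exists C, setT; split => //.
    exact: fincyls_setT.
  by apply/seteqP; split => x // [].
have msnd : measurable_fun setT ((fun x => x.2) : g_sigma_algebraType rects -> pathType T2).
  apply: (@measurability _ _ _ (pathType T2) _ _ _ (@path_measurable_fincyls _ T2)).
  move=> _ [U fU <-]; rewrite setTI; apply: sub_sigma_algebra; exists setT, U; split => //.
  by apply/seteqP; split => x // [].
have := @measurableI _ (g_sigma_algebraType rects) _ _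
  (mfst measurableT A mA) (msnd measurableT B mB).
by rewrite !setTI; congr (<<s rects >> _); apply/seteqP; split.
Qed.

(** The times [tn] are arbitrary because the step is used once forward and once backward in time;
    [jointlaw] is the common bound that [lambda_vanishing] asks for. *)
Lemma gap_step (tn : nat -> int) C : measurable C ->
  (forall B, rects B -> (gap_l (tn n) C B - gap_r (tn n) C B) @[n --> \oo] --> (0 : R)) ->
  forall B, measurable B ->
    (gap_l (tn n) C B - gap_r (tn n) C B) @[n --> \oo] --> (0 : R).
Proof.
move=> mC H.
apply: (@lambda_vanishing _ _ _ jointlaw rects (fun n => gap_l (tn n) C)
  (fun n => gap_r (tn n) C) measurable_rects rects_setI rects_setT) => //.
- move=> n A B mA mB BA; rewrite /gap_l.
  have mS := mjoint_shift (tn n) mC.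
  rewrite (_ : (A `\` B) `&` joint_shift (tn n) @^-1` C =
     (A `&` joint_shift (tn n) @^-1` C) `\` (B `&` joint_shift (tn n) @^-1` C)); last first.
    apply/seteqP; split => x /=; first by move=> [[Ax nB] Cx]; split => // -[].
    by move=> [[Ax Cx] nBC]; split => //; split => // Bx; apply: nBC.
  have mAS := measurableI _ _ mA mS; have mBS := measurableI _ _ mB mS.
  rewrite measureD//; last by rewrite ltey_eq fin_num_measure.
  rewrite fineB ?fin_num_measure//; last exact: measurableI.
  by congr (_ - fine (jointlaw _)); rewrite setIidr//; exact: setSI.
- move=> n A B mA mB BA; rewrite /gap_r; apply/eqP; rewrite eq_sym subr_eq; apply/eqP.
  rewrite -fineD ?gap_r_fin//; last exact: measurableD.
  rewrite -ge0_integral_setU//.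
  + by rewrite setUC setDUK.
  + exact: measurableD.
  + by apply: measurable_funTS; exact: mmass1.
  + by apply/disj_setPS => x [[_ nB] Bx]; exact: nB.
- move=> n A mA; rewrite /gap_l fine_ge0//= fine_le ?fin_num_measure//.
  + by apply: measurableI => //; exact: mjoint_shift.
  + by apply: le_measure; rewrite ?inE//; apply: measurableI => //; exact: mjoint_shift.
- move=> n A mA; rewrite /gap_r fine_ge0/=; last first.
    by apply: integral_ge0 => x _; exact: section_mass_ge0.
  by rewrite fine_le ?gap_r_fin ?fin_num_measure//; exact: gap_r_le.
Qed.

Lemma seq_int_bounded (s : seq int) : exists N : nat, forall j, j \in s -> (`|j| <= N)%N.
Proof.
elim: s => [|a s [N HN]]; first by exists 0%N.
exists (maxn `|a| N)%N => j; rewrite inE => /orP[/eqP ->|/HN h]; first exact: leq_maxl.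
exact: leq_trans h (leq_maxr _ _).
Qed.

(** Once the shift exceeds the spread of both cylinders, the two sets of coordinates are disjoint,
    so independence is exact and not merely asymptotic. *)
Lemma fincyls_mixing U U' : fincyls setT U -> fincyls setT U' ->
  exists N : nat, forall n : nat, (N <= n)%N ->
    nu (U `&` shiftn n%:Z @^-1` U') = (nu U * nu U')%E.
Proof.
move=> [s [A [us _ mA ->]]] [s' [A' [us' _ mA' ->]]].
have [N HN] := seq_int_bounded s; have [N' HN'] := seq_int_bounded s'.
exists (N + N').+1 => n Nn.
have dj (j : int) : j \in s' -> j + n%:Z \in s -> False.
  by move=> /HN' h1 /HN h2; lia.
pose s2 := [seq t + n%:Z | t <- s'].
have us2 : uniq s2 by rewrite map_inj_uniq// => x y /addIr.
have uss : uniq (s ++ s2).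
  rewrite cat_uniq us us2 andbT; apply/hasPn => _ /mapP[j js ->].
  by apply/negP => /(dj _ js).
pose A2 (t : int) := if t \in s then A t else A' (t - n%:Z).
have mA2 t : measurable (A2 t) by rewrite /A2; case: ifP.
have -> : fincyl s A `&` shiftn n%:Z @^-1` fincyl s' A' = fincyl (s ++ s2) A2.
  apply/seteqP; split => e.
    move=> [h1 h2] t; rewrite mem_cat /A2; case: ifPn => [ts _|ns /=]; first exact: h1.
    by move=> /mapP[j js ->]; rewrite addrK; exact: h2.
  move=> h; split => t ts.
    by have := h t; rewrite mem_cat ts /A2 ts => /(_ erefl).
  have := h (t + n%:Z); rewrite mem_cat (map_f (fun t => t + n%:Z) ts) orbT => /(_ erefl).
  by rewrite /A2 ifN ?addrK//; apply/negP; exact: dj.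
rewrite !(fincyl_law Heps_indep Heps_id)// big_cat/= EFinM.
congr (_%:E * _%:E)%E.
  rewrite big_seq [RHS]big_seq; apply: eq_bigr => j js; by rewrite /A2 js.
rewrite big_map big_seq [RHS]big_seq; apply: eq_bigr => j js.
by rewrite /A2 ifN ?addrK//; apply/negP; exact: dj.
Qed.

(** Only the noise has to decouple: the environment contributes to both sides the same factor, the
    measure of [A] intersected with the shifted [A']. *)
Lemma gap_rects B C : rects B -> rects C ->
  (gap_l n%:Z C B - gap_r n%:Z C B) @[n --> \oo] --> (0 : R).
Proof.
move=> [A [U [mA fU ->]]] [A' [U' [mA' fU' ->]]].
have mU := fincyls_measurable fU; have mU' := fincyls_measurable fU'.
have [N HN] := fincyls_mixing fU fU'.
apply: cvg_near_cst; near=> n; apply/eqP; rewrite subr_eq0; apply/eqP; congr fine.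
have mS1 : measurable (shiftn n%:Z @^-1` A' : set (pathType T1)).
  by have := @measurable_shiftn _ T1 n%:Z measurableT _ mA'; rewrite setTI.
have mS2 : measurable (shiftn n%:Z @^-1` U' : set (pathType T2)).
  by have := @measurable_shiftn _ T2 n%:Z measurableT _ mU'; rewrite setTI.
have massE (D : set (pathType T1)) (V : set (pathType T2)) z :
    section_mass (D `*` V) z = ((\1_D z)%:E * nu V)%E.
  rewrite /section_mass indicE; case: (boolP (z \in D)) => zD.
    by rewrite in_xsectionX// mul1e.
  by rewrite notin_xsectionX// measure0 mul0e.
have mAU : measurable (A `*` U : set joint) by exact: measurableX.
have mAU' : measurable (A' `*` U' : set joint) by exact: measurableX.
rewrite (integral_section mAU (mmass n%:Z mAU')); last by move=> z; exact: section_mass_ge0.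
rewrite (_ : A `*` U `&` joint_shift n%:Z @^-1` (A' `*` U') =
   (A `&` shiftn n%:Z @^-1` A') `*` (U `&` shiftn n%:Z @^-1` U')); last first.
  by apply/seteqP; split => x [[? ?] [? ?]].
rewrite jointlawE; last by apply: measurableX; exact: measurableI.
rewrite product_measure1E//; [|exact: measurableI|exact: measurableI].
rewrite [X in (_ * X)%E]HN; last by near: n; exact: nbhs_infty_ge.
have nuf V : measurable V -> exists v, nu V = v%:E /\ 0 <= v.
  move=> mV; exists (fine (nu V)); rewrite fineK ?fin_num_measure//; split => //.
  exact: fine_ge0.
have [u [uE u0]] := nuf _ mU; have [v [vE v0]] := nuf _ mU'.
under eq_integral do rewrite !massE uE vE.
have -> : (fun z => (\1_A z)%:E * u%:E * ((\1_A' (shiftn n%:Z z))%:E * v%:E))%E =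
   (fun z => (u * v)%:E * (\1_(A `&` shiftn n%:Z @^-1` A') z)%:E)%E.
  apply/funext => z; rewrite -!EFinM; congr EFin.
  rewrite indicI /= (_ : \1_(shiftn n%:Z @^-1` A') z = \1_A' (shiftn n%:Z z))//.
  by ring.
rewrite ge0_integralZl//.
- rewrite integral_indic//; last exact: measurableI.
  by rewrite setIT muleC EFinM -uE -vE.
- by apply/measurable_EFinP; apply: measurable_indic; exact: measurableI.
- by rewrite lee_fin mulr_ge0.
Unshelve. all: by end_near. Qed.

(** Rectangles are replaced by measurable sets one argument at a time: [H1] frees [B], then the
    identities [E] put [C] in the position that [gap_step] can free. *)
Lemma gap_cvg0 B C : measurable B -> measurable C ->
  (gap_l n%:Z C B - gap_r n%:Z C B) @[n --> \oo] --> (0 : R).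
Proof.
move=> mB mC.
have H1 D : rects D -> (gap_l n%:Z D B - gap_r n%:Z D B) @[n --> \oo] --> (0 : R).
  move=> rD; apply: (gap_step (tn := fun n => n%:Z)) mB; first exact: rects_measurable.
  by move=> D' rD'; exact: gap_rects.
have H2 := @gap_step (fun n => - n%:Z) B mB _ C mC.
have E D : measurable D -> (fun n : nat => gap_l (- n%:Z) B D - gap_r (- n%:Z) B D) =
    (fun n : nat => gap_l n%:Z D B - gap_r n%:Z D B).
  by move=> mD; apply/funext => n; have [-> ->] := gap_sym n%:Z mB mD.
rewrite -E//; apply: H2 => D rD; rewrite E; last exact: rects_measurable.
exact: H1.
Qed.

Lemma joint_ergodic B : measurable B -> joint_shift 1 @^-1` B = B ->
  jointlaw B = 0%E \/ jointlaw B = 1%E.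
Proof.
move=> mB BE.
have BEn (n : nat) : joint_shift n%:Z @^-1` B = B.
  elim: n => [|n IH]; first by apply/seteqP; split => x; rewrite /preimage/= joint_shift0.
  rewrite -[RHS]BE -[in RHS]IH; apply/seteqP; split => x; rewrite /preimage/= joint_shiftD;
    by rewrite -addn1 PoszD.
have massn (n : nat) z : section_mass B (shiftn n%:Z z) = section_mass B z.
  have mBz : measurable (xsection B (shiftn n%:Z z)) by exact: measurable_xsection.
  rewrite {1}/section_mass -(stationary_shiftn_law iid_stationary n%:Z mBz).
  congr (nu _); apply/seteqP; split => e; rewrite /xsection /preimage/= !inE.
    by move=> h; rewrite -(BEn n).
  by rewrite -{1}(BEn n).
have mmB := measurable_section_mass mB.
(* For an invariant [B] the gap does not depend on [n], so it equals its limit 0: P(B) is the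
   integral of P(B | Z) over [B], which forces P(B | Z) = 1 almost everywhere on [B]. *)
have BB : (\int[jointlaw]_(x in B) section_mass B x.1 = jointlaw B)%E.
  have := gap_cvg0 mB mB.
  have -> : (fun n : nat => gap_l n%:Z B B - gap_r n%:Z B B) =
     (fun=> fine (jointlaw B) - fine (\int[jointlaw]_(x in B) section_mass B x.1)%E).
    apply/funext => n; rewrite /gap_l /gap_r BEn setIid.
    by congr (_ - fine _); apply: eq_integral => x _; exact: massn.
  move=> /(cvg_lim (@Rhausdorff R)).
  rewrite (cvg_lim (@Rhausdorff R) (cvg_cst _)).
  move=> /eqP; rewrite subr_eq0 => /eqP h.
  have fi : (\int[jointlaw]_(x in B) section_mass B x.1)%E \is a fin_num.
    by have := gap_r_fin 0 mB mB; under eq_integral do rewrite shiftn0.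
  by apply/esym/eqP; rewrite -(@fineK _ (jointlaw B)) ?fin_num_measure// h fineK.
(* Ergodicity of [Z] applies to [N]. If [N] is null, so is [B], which lies above [N] up to a null
   set; if [N] is full, almost every section of [B] has mass 1. *)
pose N : set (pathType T1) := [set z | section_mass B z = 1%E].
have mN : measurable N.
  rewrite (_ : N = section_mass B @^-1` [set 1%E])//.
  by rewrite -[X in measurable X]setTI; exact: mmB.
have [|N0|N1] := HZerg mN.
- apply/seteqP; split => z; rewrite /N /preimage/= shiftnE; by rewrite (massn 1%N).
- left.
  have mf1 : measurable_fun B (fun x : joint => section_mass B x.1).
    by apply: measurable_funTS; exact: (measurableT_comp mmB measurable_fst).
  have i1 : (\int[jointlaw]_(x in B) (1 - section_mass B x.1) = 0)%E.
    have is1 : jointlaw.-integrable B (fun x : joint => section_mass B x.1).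
      apply/integrableP; split => //.
      under eq_integral do rewrite gee0_abs ?section_mass_ge0//.
      by rewrite BB ltey_eq fin_num_measure.
    rewrite integralB//; last exact: finite_measure_integrable_cst.
    by rewrite BB integral_cst// mul1e subee// fin_num_measure.
  have mf1' : measurable_fun B (fun x : joint => 1 - section_mass B x.1)%E.
    by apply: emeasurable_funB.
  have sub0 x : (0 <= 1 - section_mass B x)%E by rewrite sube_ge0 ?orbT//; exact: section_mass_le1.
  have /(ae_eq_integral_abs jointlaw mB mf1') ae0 :
      (\int[jointlaw]_(x in B) `|1 - section_mass B x.1| = 0)%E.
    by under eq_integral do rewrite gee0_abs//.
  apply/(@negligibleP _ _ _ jointlaw) => //.
  have nN : jointlaw.-negligible (N `*` setT).
    apply/negligibleP; first exact: measurableX.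
    apply: etrans (jointlawE _) _; first exact: measurableX.
    by rewrite product_measure1E// [X in (X * _)%E](_ : _ = 0%E) ?mul0e.
  apply: negligibleS (negligibleU ae0 nN) => x Bx /=.
  have [Nx|nNx] := pselect (N x.1); [by right|left => /(_ Bx)].
  move: nNx (section_mass_ge0 B x.1) (section_mass_le1 x.1 mB); rewrite /N/=.
  case: (section_mass B x.1) => [v| |]//= v1 _ _ /eqP.
  by rewrite -EFinB eqe subr_eq0 => /eqP v1'; apply: v1; rewrite -v1'.
- right; rewrite jointlawE// /product_measure1.
  transitivity (\int[mu]_z (cst 1%E z))%E; last first.
    by rewrite integral_cst// mul1e; exact: probability_setT.
  apply: ge0_ae_eq_integral => //.
  - exists (~` N); split; first exact: measurableC.
      apply: etrans (probability_setC mu mN) _.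
      by rewrite [X in (1 - X)%E](_ : _ = 1%E)// subee.
    by move=> z /=; apply: contra_not => Nz _.
Qed.

(** [orbit] intertwines the two shifts at every point, so an invariant set of paths pulls back to an
    exactly invariant set, as [joint_ergodic] requires. *)
Lemma factor_stationary_ergodic dW (W : measurableType dW) (Phi : joint -> W) :
  measurable_fun setT Phi ->
  stationary P (fun t w => Phi (joint_shift t (jointRV w))) /\
  ergodic P (fun t w => Phi (joint_shift t (jointRV w))).
Proof.
move=> mPhi.
pose orbit (x : joint) : pathType W := fun t => Phi (joint_shift t x).
have morbit : measurable_fun setT orbit.
  by apply: measurable_fun_path => t; exact: (measurableT_comp mPhi (@measurable_joint_shift t)).
have mpre (B : set (pathType W)) : measurable B -> measurable (orbit @^-1` B).
  by move=> mB; have := morbit measurableT B mB; rewrite setTI.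
have orbit_joint_shift x : orbit (joint_shift 1 x) = Defs.shift (orbit x).
  by apply/funext => t; rewrite /orbit joint_shiftD.
split=> B mB.
  have := jointlaw_joint_shift 1 (mpre _ mB); congr (_ = _); congr (P _).
  apply/seteqP; split => w /=.
    by rewrite /preimage/= orbit_joint_shift.
  by move=> h; rewrite /preimage/= orbit_joint_shift.
move=> BE; have [|h|h] := joint_ergodic (mpre _ mB); [|by left|by right].
apply/funext => x; rewrite /preimage/= orbit_joint_shift.
exact: (congr1 (@^~ (orbit x)) BE).
Qed.

End Joint.

(** * The pullback limit as a factor of environment and noise *)

Section Factor.
Context (R : realType) dO (Omega : measurableType dO) (P : probability Omega R).
Context dE (E : measurableType dE) (dist : E -> E -> R).
Context d1 (T1 : measurableType d1) d2 (T2 : measurableType d2).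
Hypothesis HE : polish_borel dist.
Variable Z : int -> {mfun Omega >-> T1}.
Variable eps : int -> {mfun Omega >-> T2}.
Hypothesis HZstat : stationary P (fun t w => Z t w).
Hypothesis HZerg : ergodic P (fun t w => Z t w).
Hypothesis Heps_indep : mutually_independent P (fun t w => eps t w).
Hypothesis Heps_id : identically_distributed P (fun t w => eps t w).
Hypothesis HepsZ : independent_sigma P (sigma_gen (fun t w => eps t w) setT)
                               (sigma_gen (fun t w => Z t w) setT).
Variable F : E * T1 * T2 -> E.
Hypothesis mF : measurable_fun setT F.
Variable x0 : E.

Notation joint := (pathType T1 * pathType T2)%type.
Notation jcomp := (fcomp F (fun t (x : joint) => x.1 t) (fun t (x : joint) => x.2 t)).

Lemma fcomp_joint_shift t s n x w :
  jcomp s n x (joint_shift t (jointRV Z eps w)) =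
  fcomp F (fun t w => Z t w) (fun t w => eps t w) (s + t) n x w.
Proof.
elim: n => [|n IH] //=; rewrite IH /frand /joint_shift/= /shiftn /pathRV.
rewrite (_ : s + n%:Z - 1 + t = s + t + n%:Z - 1); last first.
  by rewrite addrAC; congr (_ - 1); rewrite addrAC.
by rewrite (_ : s + n%:Z + t = s + t + n%:Z)// addrAC.
Qed.

Lemma measurable_jcomp s n x : measurable_fun setT (jcomp s n x).
Proof.
elim: n => [|n IH] /=; first exact: measurable_cst.
apply: (measurable_fun_F mF) => //.
  exact: (measurableT_comp (@measurable_path_eval _ T1 _) measurable_fst).
exact: (measurableT_comp (@measurable_path_eval _ T2 _) measurable_snd).
Qed.

Lemma limit_stationary_ergodic :
  stationary P (fun t w => (pullback_limit dist Z eps F x0 t w, Z t w)) /\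
  ergodic P (fun t w => (pullback_limit dist Z eps F x0 t w, Z t w)).
Proof.
(* [Phi] reads the limit at time 0 on the canonical space. Both limits are [mlim] of the same
   sequence, default value included, so the factor identity holds at every sample point. *)
pose Phi (x : joint) := (mlim dist x0 (fun n => jcomp (0 - n%:Z + 1) n x0 x), x.1 0).
have mPhi : measurable_fun setT Phi.
  apply: measurable_fun_pair.
    by apply: (measurable_mlim HE) => n; exact: measurable_jcomp.
  exact: (measurableT_comp (@measurable_path_eval _ T1 _) measurable_fst).
have -> : (fun t w => (pullback_limit dist Z eps F x0 t w, Z t w)) =
    (fun t w => Phi (joint_shift t (jointRV Z eps w))).
  apply/funext => t; apply/funext => w; congr pair; last by rewrite /= /shiftn add0r.
  rewrite /pullback_limit; congr mlim; apply/funext => n; rewrite fcomp_joint_shift.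
  by rewrite add0r [_ + t]addrC addrA.
exact: factor_stationary_ergodic.
Qed.

End Factor.

(** * Extension of the data beyond [E1'], and assembly *)

Lemma fcomp_ext (E E1 E2 Omega : Type) (F F' : E * E1 * E2 -> E)
    (Z : int -> Omega -> E1) (eps : int -> Omega -> E2) s n x w :
  (forall y t u, F (y, Z t w, u) = F' (y, Z t w, u)) ->
  fcomp F Z eps s n x w = fcomp F' Z eps s n x w.
Proof. by move=> FF'; elim: n => [|n IH] //=; rewrite IH /frand FF'. Qed.

Lemma measurable_fun_mem d (T : measurableType d) (A : set T) : measurable A ->
  measurable_fun setT (fun x => x \in A).
Proof.
move=> mA; apply: (measurable_fun_bool true); rewrite setTI.
by rewrite (_ : _ @^-1` _ = A)//; apply/seteqP; split => x /=; [exact: set_mem|exact: mem_set].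
Qed.

Lemma measurable_fun_extend d d' (T : measurableType d) (T' : measurableType d')
    (A : set T) (f : T -> T') (y : T') : measurable A -> measurable_fun A f ->
  measurable_fun setT (fun x => if x \in A then f x else y).
Proof.
move=> mA mf; apply: measurable_fun_if => //.
- exact: measurable_fun_mem.
- rewrite setTI (_ : _ @^-1` _ = A)//; apply/seteqP; split => x /=; [exact: set_mem|exact: mem_set].
Qed.

Theorem theorem3
  (R : realType) (dO : measure_display) (Omega : measurableType dO)
  (P : probability Omega R)
  (* (E, dist) Polish, with its Borel sigma-algebra *)
  (dE : measure_display) (E : measurableType dE) (dist : E -> E -> R)
  (HE : polish_borel dist)
  (* E1' a Borel subset of R^e *)
  (e : nat) (E1' : set (e.-tuple R)) (mE1' : measurable E1')
  (* E2' Polish, with its Borel sigma-algebra *)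
  (d2 : measure_display) (E2 : measurableType d2) (dist2 : E2 -> E2 -> R)
  (HE2 : polish_borel dist2)
  (* F : E x E1' x E2' -> E measurable *)
  (F : E * e.-tuple R * E2 -> E)
  (mF : measurable_fun ([set: E] `*` E1' `*` [set: E2]) F)
  (Z : int -> {mfun Omega >-> e.-tuple R})
  (eps : int -> {mfun Omega >-> E2})
  (p : R) (x0 : E) (hp : 1 <= p)
  (* (A0) *)
  (HZval : forall t w, E1' (Z t w))
  (HZstat : stationary P (fun t w => Z t w))
  (HZerg : ergodic P (fun t w => Z t w))
  (Heps_indep : mutually_independent P (fun t w => eps t w))
  (Heps_id : identically_distributed P (fun t w => eps t w))
  (HepsZ : independent_sigma P (sigma_gen (fun t w => eps t w) setT)
                               (sigma_gen (fun t w => Z t w) setT))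
  (* (A1') *)
  (A1 : forall z, E1' z ->
     (\int[P]_w ((dist (F (x0, z, eps 1%R w)) x0) `^ p)%:E < +oo)%E)
  (* (A2') *)
  (A2 : exists kappa : e.-tuple R -> R,
     measurable_fun E1' kappa /\
         (forall z, E1' z -> 0 < kappa z) /\
         (\int[P]_w (logp (kappa (Z 0%R w)))%:E < +oo)%E /\
         (\int[P]_w (ln (kappa (Z 0%R w)))%:E < 0)%E /\
         (forall x y z, E1' z ->
            (\int[P]_w ((dist (F (x, z, eps 0%R w)) (F (y, z, eps 0%R w))) `^ p)%:E
              <= ((kappa z) `^ p * (dist x y) `^ p)%:E)%E) /\
         (\int[P]_w elogp (\int[distribution P (eps 1%R)]_u
                               ((dist x0 (F (x0, Z 0%R w, u))) `^ p)%:E) < +oo)%E) :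
  exists X : E -> int -> Omega -> E,
    (forall x t, measurable_fun [set: Omega] (X x t)) /\
    (* 1. *)
    (forall x t,
       (forall g, cond_exp_version P (sigma_gen (fun t w => Z t w) setT)
                        (fun w => ((dist (X x t w) x0) `^ p)%:E) g ->
                      {ae P, forall w, (g w < +oo)%E}) /\
           (forall g : nat -> Omega -> \bar R,
              (forall s : nat, cond_exp_version P (sigma_gen (fun t w => Z t w) setT)
                 (fun w => ((dist (fcomp F (fun t w => Z t w) (fun t w => eps t w)
                                          (t - s%:Z) s.+1 x w) (X x t w)) `^ p)%:E)
                 (g s)) ->
              {ae P, forall w, (fun s => g s w) @ \oo --> 0%E}) /\
           {ae P, forall w,
              (fun s : nat => dist (fcomp F (fun t w => Z t w) (fun t w => eps t w)
                                          (t - s%:Z) s.+1 x w) (X x t w)) @ \oo --> 0}) /\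
    (* 2. *)
    (forall x y t, x <> y -> P [set w | X x t w <> X y t w] = 0%E) /\
    (* 3. *)
    (forall x, stationary P (fun t w => (X x t w, Z t w)) /\
               ergodic P (fun t w => (X x t w, Z t w))) /\
    (* 4. *)
    (forall Y : int -> Omega -> E,
       (forall t (B : set E), measurable B ->
          sigma_gen2 (fun j w => Z j w) (fun j w => eps j w) [set j | j <= t]
                     (Y t @^-1` B)) ->
       stationary P (fun t w => (Y t w, Z t w)) ->
       (forall t w, Y t w = F (Y (t - 1) w, Z (t - 1) w, eps t w)) ->
       (exists g, cond_exp_version P (sigma_gen (fun t w => Z t w) [set j | j <= 0])
                    (fun w => ((dist (Y 0 w) x0) `^ p)%:E) g /\
                  {ae P, forall w, (g w < +oo)%E}) ->
       forall x t, P [set w | Y t w <> X x t w] = 0%E).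
Proof.
have [kappa [mk [k0 [klogp [kln [Hc Hlog]]]]]] := A2.
pose D : set (E * e.-tuple R * E2) := [set: E] `*` E1' `*` [set: E2].
have mD : measurable D by apply: measurableX => //; exact: measurableX.
(* Nothing is assumed on [F] and [kappa] outside [E1']. The constant value [x0] and the factor 1
   keep measurability and make the contraction trivial there; [Z] stays in [E1'], so the runs do not
   change. *)
pose F' x := if x \in D then F x else x0.
have mF' : measurable_fun setT F' by exact: measurable_fun_extend.
pose k' z := if z \in E1' then kappa z else 1.
have mk' : measurable_fun setT k' by exact: measurable_fun_extend.
have FF' y z u : E1' z -> F (y, z, u) = F' (y, z, u).
  by move=> Ez; rewrite /F' mem_set.
have FN y z u : ~ E1' z -> F' (y, z, u) = x0.
  by move=> nE; rewrite /F' memNset// => -[[_ /=]].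
have kk' z : E1' z -> k' z = kappa z by move=> Ez; rewrite /k' mem_set.
have k'0 z : 0 < k' z by rewrite /k'; case: ifPn => //; rewrite inE => /k0.
have FZ w y t u : F (y, Z t w, u) = F' (y, Z t w, u) by apply: FF'.
have p0 : p != 0 by rewrite gt_eqF// (lt_le_trans ltr01).
have mdF (x y : E) z : measurable_fun setT (fun u => (dist (F' (x, z, u)) (F' (y, z, u)) `^ p)%:E).
  apply/measurable_EFinP; apply: (measurable_fun_distp HE);
    by apply: (measurable_fun_F mF') => //; exact: measurable_cst.
have mdx z : measurable_fun setT (fun u => (dist x0 (F' (x0, z, u)) `^ p)%:E).
  apply/measurable_EFinP; apply: (measurable_fun_distp HE); first exact: measurable_cst.
  by apply: (measurable_fun_F mF') => //; exact: measurable_cst.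
have Hc' x y z : (\int[distribution P (eps 0%R)]_u (dist (F' (x, z, u)) (F' (y, z, u)) `^ p)%:E
     <= (k' z `^ p * dist x y `^ p)%:E)%E.
  have [Ez|nE] := pselect (E1' z).
    rewrite ge0_integral_distribution//; last by move=> u; rewrite lee_fin powR_ge0.
    rewrite kk'//; apply: le_trans (Hc x y z Ez); rewrite le_eqVlt; apply/orP; left.
    by apply/eqP; apply: eq_integral => w _; rewrite /= !FF'.
  under eq_integral do rewrite !FN// (distxx HE) powR0//.
  by rewrite integral0 lee_fin mulr_ge0// powR_ge0.
(* [A1] makes [cc] finite at every point of [E1'], so it can be replaced by a real function [c], on
   which [elogp] is [logp]. *)
pose cc z := (\int[distribution P (eps 0%R)]_u (dist x0 (F' (x0, z, u)) `^ p)%:E)%E.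
have cc0 z : (0 <= cc z)%E by apply: integral_ge0 => u _; rewrite lee_fin powR_ge0.
have ccfin z : cc z \is a fin_num.
  rewrite ge0_fin_numE//; have [Ez|nE] := pselect (E1' z); last first.
    rewrite /cc; under eq_integral do rewrite FN// (distxx HE) powR0//.
    by rewrite integral0 ltry.
  (* [A1] uses the noise at time 1 and [cc] the noise at time 0; the two have the same law. *)
  rewrite /cc -(integral_noise_law Heps_id 1) ge0_integral_distribution//; last first.
    by move=> u; rewrite lee_fin powR_ge0.
  apply: le_lt_trans (A1 _ Ez); rewrite le_eqVlt; apply/orP; left.
  by apply/eqP; apply: eq_integral => w _; rewrite /= (distC HE) FF'.
pose c z := fine (cc z).
have cE z : cc z = (c z)%:E by rewrite fineK.
have mcc : measurable_fun setT cc.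
  have mh : measurable_fun setT
      (fun x : e.-tuple R * E2 => (dist x0 (F' (x0, x.1, x.2)) `^ p)%:E).
    apply/measurable_EFinP; apply: (measurable_fun_distp HE); first exact: measurable_cst.
    by apply: (measurable_fun_F mF') => //; exact: measurable_cst.
  apply: (measurable_fun_fubini_tonelli_F (m2 := distribution P (eps 0)) _ mh).
  by move=> x; rewrite lee_fin powR_ge0.
have mc : measurable_fun setT c by exact: (measurableT_comp (fine_measurable _)).
have c0 z : 0 <= c z by exact: fine_ge0.
have clogp : (\int[P]_w (logp (c (Z 0 w)))%:E < +oo)%E.
  apply: le_lt_trans Hlog; rewrite le_eqVlt; apply/orP; left; apply/eqP.
  apply: eq_integral => w _; rewrite (integral_noise_law Heps_id 1).
  rewrite (_ : (\int[_]_u _)%E = (c (Z 0 w))%:E)//.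
  by rewrite -cE; apply: eq_integral => u _; rewrite FZ.
have [||q [q0 q1 gq]] := good_ae HZstat HZerg hp mk' k'0 mc c0 _ _ clogp.
- by under eq_integral do rewrite kk'//.
- by under eq_integral do rewrite kk'//.
have fE s n x w : fcomp F (fun t w => Z t w) (fun t w => eps t w) s n x w =
    fcomp F' (fun t w => Z t w) (fun t w => eps t w) s n x w.
  by apply: fcomp_ext => y t u; exact: FZ.
(* One process serves every starting point, so the event of the second claim is empty. *)
exists (fun _ => pullback_limit dist Z eps F' x0); split; first by move=> _ t; exact: measurable_pullback_limit.
split; [|split; [|split]].
- move=> x t; split; [|split].
  + by move=> g; exact: (cond_exp_pullback_limit_finite HE HZstat Heps_indep Heps_id HepsZ mF' hp mk' Hc' mc cE q0 q1 gq).
  + move=> g gP; apply: (cond_exp_cvg0 HE HZstat Heps_indep Heps_id HepsZ mF' hp mk' Hc' mc cE q0 q1 gq (x := x)).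
    move=> s; have := gP s; congr (cond_exp_version _ _ _ _).
    by apply/funext => w; rewrite fE.
  + have := fcomp_cvg HE HZstat Heps_indep Heps_id HepsZ mF' hp mk' Hc' mc cE q0 q1 gq t x.
    by apply: filterS => w H; under eq_cvg do rewrite fE.
- move=> x y t _; rewrite (_ : mkset _ = set0) ?measure0//.
  by apply/seteqP; split => w //=.
- by move=> x; exact: limit_stationary_ergodic.
- move=> Y Ypast YZ Yrec [g [gP goo]] x t.
  apply: (stationary_solution_unique HE HZstat Heps_indep Heps_id HepsZ mF' hp mk' Hc' mc cE q0 q1 gq Ypast YZ _ gP goo).
  by move=> s w; rewrite Yrec FZ.
Qed.
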